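(* Let $(E,\|\cdot\|)$ be a $\mathbb{C}$-Banach space. The following conditions are equivalent: 1. Every holomorphic map $\gamma:\bar{\mathbb{D}}\to E$ whose image is contained in the unit sphere is constant. 2. For all strictly convex maps $\psi:\mathbb{R}\cup\{-\infty\}\to\mathbb{R}\cup\{-\infty\}$, the composition $\psi\circ\log\|\cdot\|$ is strictly plurisubharmonic on $E$. 3. There exists a strictly convex map $\psi:\mathbb{R}\cup\{-\infty\}\to\mathbb{R}\cup\{-\infty\}$ such that the composition $\psi\circ\log\|\cdot\|$ is strictly plurisubharmonic on $E$.
   Context: $\bar{\mathbb{D}}\subset\mathbb{C}$ is the closed unit disc; a map defined on $\bar{\mathbb{D}}$ is holomorphic if it extends to a holomorphic map on a neighbourhood of $\bar{\mathbb{D}}$. By convention $\log 0=-\infty$. A map $\psi:\mathbb{R}\cup\{-\infty\}\to\mathbb{R}\cup\{-\infty\}$ is convex if it is continuous and its restriction to $\mathbb{R}$ is finite and convex; if in addition $\psi|_{\mathbb{R}}$ is strictly convex, then $\psi$ is strictly convex. An upper semicontinuous function $f:X\to\mathbb{R}\cup\{-\infty\}$ on a holomorphic manifold $X$ (for instance $X=E$) is plurisubharmonic if for all holomorphic maps $\gamma:\bar{\mathbb{D}}\to X$, $f(\gamma(0))\leq\frac{1}{2\pi}\int_0^{2\pi}f(\gamma(e^{it}))\,dt$ (the integral being an element of $\mathbb{R}\cup\{-\infty\}$); it is strictly plurisubharmonic if moreover this inequality is strict whenever $\gamma$ is non-constant. *)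

(* Defs.v *)
From HB Require Import structures.
From mathcomp Require Import all_boot all_order all_algebra.
From mathcomp Require Import all_classical all_reals all_analysis.
From mathcomp Require Export complex.

Set Implicit Arguments.
Unset Strict Implicit.
Unset Printing Implicit Defensive.

Import Order.TTheory GRing.Theory Num.Theory.
Import numFieldNormedType.Exports.

Local Open Scope classical_set_scope.
Local Open Scope ring_scope.

(** Maps on R ∪ {-oo}.  This space is the subspace [ninfty_line R] of [\bar R],
    and a self-map of it is a map [\bar R -> \bar R] preserving it; the value at
    +oo is irrelevant. *)

Section Convexity.
Variable R : realType.
Implicit Type psi : \bar R -> \bar R.

Definition ninfty_line : set (\bar R) := [set x | x != +oo%E].

Definition real_restriction psi : R -> R := fun r => fine (psi r%:E).

Definition convex_map psi :=
  [/\ set_fun ninfty_line ninfty_line psi,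
      {within ninfty_line, continuous psi},
      (forall r : R, psi r%:E \is a fin_num)
    & convex_function (R := R) (E := R^o) setT (real_restriction psi)].

Definition strictly_convex_map psi := convex_map psi /\
  forall (x y t : R), x != y -> 0 < t < 1 ->
    real_restriction psi (t * x + (1 - t) * y) <
    t * real_restriction psi x + (1 - t) * real_restriction psi y.

End Convexity.

Section Holomorphy.
Variables (R : realType) (E : normedModType R[i]).
Local Notation C := (R[i]^o).

Definition closed_disc : set C := [set z | `|z| <= 1].

Definition circle_point (t : R) : C := (cos t +i* sin t)%C.

(** [holomorphic_on_disc gamma] and [constant_on_disc gamma] depend only on
    the restriction of [gamma] to the closed disc; [derivable _ z 1] over the
    base field [R[i]] is the existence of the complex derivative at [z]. *)
Definition holomorphic_on_disc (gamma : C -> E) :=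
  exists (U : set C) (g : C -> E),
    [/\ open U, closed_disc `<=` U,
        (forall z, U z -> derivable g z 1)
      & (forall z, closed_disc z -> g z = gamma z)].

Definition constant_on_disc (gamma : C -> E) :=
  exists c : E, forall z, closed_disc z -> gamma z = c.

End Holomorphy.

Section Plurisubharmonicity.
Variables (R : realType) (E : normedModType R[i]).
Local Notation C := (R[i]^o).
Local Open Scope ereal_scope.
Implicit Type f : E -> \bar R.

Definition upper_semicontinuous f :=
  forall (x : E) (a : R), f x < a%:E -> \forall y \near x, f y < a%:E.

(** An upper semicontinuous [f] avoiding +oo is bounded above on the image of
    the circle, so the integral of its positive part is finite and the
    extended integral is a well-defined element of R ∪ {-oo}. *)
Definition circle_mean f (gamma : C -> E) : \bar R :=
  ((2 * pi)^-1)%:E *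
  \int[lebesgue_measure]_(t in `[0%R, (2 * pi)%R]) f (gamma (circle_point t)).

Definition plurisubharmonic f :=
  [/\ (forall x, f x != +oo), upper_semicontinuous f
    & forall gamma : C -> E, holomorphic_on_disc gamma ->
        f (gamma 0%R) <= circle_mean f gamma].

Definition strictly_plurisubharmonic f := plurisubharmonic f /\
  forall gamma : C -> E, holomorphic_on_disc gamma ->
    ~ constant_on_disc gamma -> f (gamma 0%R) < circle_mean f gamma.

(** The norm of [E] takes its values in the nonnegative reals of [R[i]];
    [lne] sends 0 to -oo. *)
Definition log_norm (x : E) : \bar R := lne (complex.Re `|x|)%:E.

End Plurisubharmonicity.

(* Main.v *)
Require Import Defs.
From HB Require Import structures.
From mathcomp Require Import all_boot all_order all_algebra.
From mathcomp Require Import all_classical all_reals all_analysis.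
From mathcomp Require Import measurable_realfun.
From mathcomp Require Import ring lra.

(** The implication (1) => (2) rests on the subharmonicity of [log |gamma|].
    By Hahn-Banach it suffices to treat a scalar function [h].  Mere complex
    differentiability gives the mean value property: Goursat's bisection applied
    to [w |-> h (exp w)] on a rectangle of height [2 pi] shows that the circle
    means of [Re h] do not depend on the radius.  Hence the maximum principle,
    which for [H z = \prod_(k < n) h (u ^ k z)], [u] a primitive [n]-th root of
    unity, bounds [n log |h 0|] by a Riemann sum of [log |h|] over the circle, up
    to [o(n)].  Taking the mean around another point [a], by means of the Moebius
    map sending [0] to [a], shows that [log |gamma|] has finite circle mean as
    soon as [gamma] is not identically zero.

    Given this, Jensen's inequality is a support line of [psi] at [log |gamma 0|],
    and it is strict unless [|gamma|] is constant on the circle; in that case a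
    norming functional at [gamma 0] and the maximum principle force [|gamma|] to
    be constant on the whole disc, where (1) applies.  All logarithms are
    regularised to [log (|gamma| + e)], and [e] tends to 0 by monotone
    convergence only at the end. *)

Set Implicit Arguments.
Unset Strict Implicit.
Unset Printing Implicit Defensive.

Import Order.TTheory GRing.Theory Num.Theory.
Import numFieldNormedType.Exports.

Local Open Scope classical_set_scope.
Local Open Scope complex_scope.
Local Open Scope ring_scope.

(** * Primitives and oriented integrals of continuous functions *)

Section Primitives.
Variable R : realType.
Implicit Types (f g F G : R -> R) (a b c x y : R).

Local Notation mu := (@lebesgue_measure R).

(** Holomorphy here gives a complex derivative at each point and no continuity of that derivative,
    which is why Goursat's argument is run from first-order expansions alone. In logarithmic
    coordinates the horizontal sides of the rectangle cancel by periodicity. One real flux identity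
    is enough, because a rotation turns [h 0] into its norm.

    The regularisation keeps every integrand continuous on the circle, so means are handled as
    differences of primitives until the final limit. Strictness has to survive this limit: the gain
    over the support line is bounded below on a fixed arc, independently of [e].

    Continuity of [psi] at [-oo] is what makes [psi] increasing; support lines then have positive
    slope and may multiply the inequality for the logarithm. Finiteness of the logarithmic mean
    serves the case where [gamma 0 = 0] and [psi -oo = -oo]: there strictness says exactly that the
    mean is not [-oo].

    For (3) => (1), a disc inside the unit sphere makes the composite constant, so the mean value
    inequality is an equality. *)

Lemma continuous_integrable_itv f a b : continuous f ->
  mu.-integrable `[a, b] (EFin \o f).
Proof.
move=> cf; apply: continuous_compact_integrable; first exact: segment_compact.
exact: continuous_subspaceT.
Qed.

(** Integrating from -1 gives a primitive on []-1, +oo[], and the same for the reflected function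
    gives one on []-oo, 1[]. They differ by a constant on the overlap, a neighbourhood of 0, where
    they are glued. *)
Lemma exists_primitive f : continuous f ->
  exists F, forall x, is_derive x 1 F (f x).
Proof.
move=> cf.
have prim g : continuous g ->
    forall x, -1 < x -> is_derive x 1 (fun y => \int[mu]_(t in `[-1, y]) g t) (g x).
  move=> cg x x1.
  have [||||dg gE] := @continuous_FTC1_closed _ g (-1) x (x + 1).
  - by rewrite ltrDl.
  - exact: continuous_integrable_itv.
  - done.
  - exact: cg.
  - by rewrite derive1E in gE; split.
pose g y := f (- y).
have cg : continuous g.
  by move=> x; apply: (@continuous_comp _ _ _ -%R f); [exact: opp_continuous|exact: cf].
pose G1 y := \int[mu]_(t in `[-1, y]) f t.
pose G2 y := - \int[mu]_(t in `[-1, - y]) g t.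
have d1 x : -1 < x -> is_derive x 1 G1 (f x) by exact: prim.
have d2 x : x < 1 -> is_derive x 1 G2 (f x).
  move=> x1; have Nx : -1 < - x by rewrite ltrN2.
  have := prim g cg (- x) Nx => dg.
  have dN : is_derive x 1 (-%R : R -> R) (-1) by exact: is_deriveNid.
  have := @is_derive1_comp _ (fun y => \int[mu]_(t in `[-1, y]) g t) -%R x _ _ dg dN.
  move=> h; have := is_deriveN h => /is_derive_eq; apply.
  by rewrite mulrN1 opprK /g opprK.
have dc x y : -1 < x -> x < y -> y < 1 -> G1 x - G2 x = G1 y - G2 y.
  move=> x1 xy y1.
  pose D z := G1 z - G2 z.
  have dD (z : R) : -1 < z -> z < 1 -> is_derive z 1 D 0.
    move=> z1 z2; have := is_deriveB (d1 _ z1) (d2 _ z2).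
    by move/is_derive_eq; apply; rewrite subrr.
  have [||z _] := @MVT _ D (fun=> 0) x y xy.
  - move=> z; rewrite in_itv /= => /andP[xz zy].
    by apply: dD; [exact: lt_trans xz|exact: lt_trans y1].
  - apply: derivable_within_continuous => z; rewrite in_itv /= => /andP[xz zy].
    by have [] := dD z (lt_le_trans x1 xz) (le_lt_trans zy y1).
  - by rewrite mul0r => /eqP; rewrite subr_eq0 => /eqP.
have c0 x : -1 < x -> x < 1 -> G1 x - G2 x = G1 0 - G2 0.
  move=> x1 x2; have [x0|x0|->//] := ltgtP x 0; first exact: dc.
  by symmetry; apply: dc => //; rewrite ltrN10.
exists (fun y => if y < 0 then G2 y + (G1 0 - G2 0) else G1 y) => x.
have [x0|x0] := ltP x 0.
- have -> : f x = f x + 0 by rewrite addr0.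
  apply: (@near_eq_is_derive _ _ _ (fun y => G2 y + (G1 0 - G2 0))).
  - near=> y; rewrite ifT //; near: y; exact: lt_nbhsl.
  - apply: is_deriveD; first by apply: d2; exact: lt_trans x0 _.
- apply: (@near_eq_is_derive _ _ _ G1).
  - near=> y; case: ifPn => // y0; rewrite -(c0 y) ?subrKC //; last by lra.
    by near: y; apply: lt_nbhsr; rewrite (lt_le_trans _ x0) ?ltrN10.
  - by apply: d1; exact: lt_le_trans x0.
Unshelve. all: by end_near. Qed.

Definition prim f : R -> R :=
  xget (fun=> 0) [set F | forall x, is_derive x 1 F (f x)].

Lemma is_derive_prim f : continuous f -> forall x, is_derive x 1 (prim f) (f x).
Proof.
move=> /exists_primitive[F dF].
by apply: (@xgetPex _ _ [set F | forall x, is_derive x 1 F (f x)]); exists F.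
Qed.

(* The integral of [f] from [a] to [b], in either order; meaningful only when
   [f] is continuous on the whole line, since otherwise [prim f] is junk. *)
Definition oint f a b := prim f b - prim f a.

Lemma derive_ge0_le F f a b : a <= b -> (forall x, is_derive x 1 F (f x)) ->
  (forall x, a <= x <= b -> 0 <= f x) -> F a <= F b.
Proof.
rewrite le_eqVlt => /predU1P[-> //|ab] dF f0.
have [|x] := @MVT _ F f a b ab (fun x _ => dF x).
  by apply: derivable_within_continuous => x _; have [] := dF x.
rewrite in_itv /= => /andP[ax xb] FE.
by rewrite -subr_ge0 FE mulr_ge0 ?subr_ge0 ?f0 ?(ltW ab)// (ltW ax) (ltW xb).
Qed.

Lemma ointE F f a b : (forall x, is_derive x 1 F (f x)) -> continuous f ->
  oint f a b = F b - F a.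
Proof.
move=> dF cf; have dp := is_derive_prim cf.
have D x y : x <= y -> oint f x y = F y - F x.
  move=> xy; have d1 z := is_deriveB (dp z) (dF z).
  have d2 z := is_deriveB (dF z) (dp z).
  have h z : x <= z <= y -> 0 <= f z - f z by rewrite subrr.
  have := derive_ge0_le xy d1 h; have := derive_ge0_le xy d2 h.
  by rewrite /oint !fctE; lra.
have [/D //|/ltW/D] := leP a b; rewrite /oint; lra.
Qed.

Lemma oint_le f g a b : a <= b -> continuous f -> continuous g ->
  (forall x, a <= x <= b -> f x <= g x) -> oint f a b <= oint g a b.
Proof.
move=> ab cf cg fg.
have d z := is_deriveB (is_derive_prim cg z) (is_derive_prim cf z).
have h z : a <= z <= b -> 0 <= g z - f z by move=> zab; rewrite subr_ge0; exact: fg.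
by have := derive_ge0_le ab d h; rewrite /oint !fctE; lra.
Qed.

Lemma ointD f g a b : continuous f -> continuous g ->
  oint (fun x => f x + g x) a b = oint f a b + oint g a b.
Proof.
move=> cf cg.
have d z := is_deriveD (is_derive_prim cf z) (is_derive_prim cg z).
rewrite (ointE _ _ d) /oint ?fctE; first lra.
by move=> x; apply: cvgD; [exact: cf|exact: cg].
Qed.

Lemma ointZ k f a b : continuous f ->
  oint (fun x => k * f x) a b = k * oint f a b.
Proof.
move=> cf.
have d z := is_deriveZ k (is_derive_prim cf z).
rewrite (ointE _ _ d) /oint ?fctE /=; first by rewrite /GRing.scale /= mulrBr.
by move=> x; apply: cvgMr; exact: cf.
Qed.

Lemma oint_cst k a b : oint (fun=> k) a b = k * (b - a).
Proof.
have d (z : R) : is_derive z 1 (fun y => k * y) k.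
  have := is_deriveZ k (is_derive_id z (1 : R)).
  by move/is_derive_eq; apply; rewrite /GRing.scale /= mulr1.
by rewrite (ointE _ _ d) -?mulrBr //; exact: cst_continuous.
Qed.

Lemma oint_chasles f a b c : oint f a b + oint f b c = oint f a c.
Proof. by rewrite /oint; lra. Qed.

Lemma oint_subst f s ds a b : continuous f -> continuous ds ->
  (forall x, is_derive x 1 s (ds x)) ->
  oint (fun x => f (s x) * ds x) a b = oint f (s a) (s b).
Proof.
move=> cf cds dss.
have d x := @is_derive1_comp _ (prim f) s x _ _ (is_derive_prim cf (s x)) (dss x).
rewrite (ointE _ _ d) //.
move=> x; apply: cvgM; last exact: cds.
apply: (@continuous_comp _ _ _ s f); last exact: cf.
by apply: differentiable_continuous; apply/derivable1_diffP; have [] := dss x.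
Qed.

Lemma oint_periodic f T a b : continuous f -> (forall x, f (x + T) = f x) ->
  oint f a (a + T) = oint f b (b + T).
Proof.
move=> cf fT.
suff E : oint f a b = oint f (a + T) (b + T) by rewrite /oint in E *; lra.
have dss (x : R) : is_derive x 1 (fun y => y + T) (1 : R).
  have := is_deriveD (is_derive_id x (1 : R)) (is_derive_cst T x (1 : R)).
  by move/is_derive_eq; apply; rewrite addr0.
rewrite -(oint_subst a b cf _ dss); last by move=> x; exact: cvg_cst.
by congr (oint _ a b); apply/funext => x; rewrite fT mulr1.
Qed.

(** The bridge back to the Lebesgue integral of [circle_mean]. *)
Lemma Rintegral_oint f a b : a < b -> continuous f ->
  (\int[mu]_(x in `[a, b]) (f x)%:E = (oint f a b)%:E)%E.
Proof.
move=> ab cf; have dp := is_derive_prim cf.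
have cp : continuous (prim f).
  by move=> x; apply: differentiable_continuous; apply/derivable1_diffP; have [] := dp x.
rewrite (@continuous_FTC2 _ f (prim f)) //.
- exact: continuous_subspaceT.
- split.
  + by move=> x _; have [] := dp x.
  + by apply: cvg_at_right_filter; exact: cp.
  + by apply: cvg_at_left_filter; exact: cp.
- by move=> x _; rewrite derive1E; have [] := dp x.
Qed.

End Primitives.

(** * Goursat's lemma for real fields *)

Section Goursat.
Variables (R : realType) (P Q : R -> R -> R).
Implicit Types (a c u v x y d e : R).

(** The outward flux of the field [(P, - Q)] through the boundary of the rectangle with corner
    [(x, y)] and sides [u], [v]. It is also the imaginary part of the contour integral of
    [P + i Q]. *)
Definition flux x y u v :=
  oint (P (x + u)) y (y + v) - oint (P x) y (y + v)
  - (oint (Q^~ (y + v)) x (x + u) - oint (Q^~ y) x (x + u)).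

Lemma flux_quarters x y u v :
  flux x y (u + u) (v + v) = flux x y u v + flux (x + u) y u v
    + flux x (y + v) u v + flux (x + u) (y + v) u v.
Proof. by rewrite /flux /oint !addrA; lra. Qed.

(** Both pairs of opposite sides contribute the same main term [k * u * v], which cancels; only the
    errors remain. *)
Lemma flux_le x y u v k w : 0 <= u -> 0 <= v ->
  continuous (P x) -> continuous (P (x + u)) ->
  continuous (Q^~ y) -> continuous (Q^~ (y + v)) ->
  (forall t, y <= t <= y + v -> `|P (x + u) t - P x t - k * u| <= w) ->
  (forall t, x <= t <= x + u -> `|Q t (y + v) - Q t y - k * v| <= w) ->
  `|flux x y u v| <= w * (u + v).
Proof.
move=> u0 v0 cP cP' cQ cQ' hP hQ.
have cD (f : R -> R) (z : R) : continuous f -> continuous (fun t => f t + z).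
  by move=> cf t; apply: cvgD; [exact: cf|exact: cvg_cst].
have cC (z : R) : continuous (fun _ : R => z) by move=> t; exact: cvg_cst.
have yv : y <= y + v by rewrite lerDl.
have xu : x <= x + u by rewrite lerDl.
have h1 : oint (P (x + u)) y (y + v) <= oint (fun t => P x t + (k * u + w)) y (y + v).
  apply: oint_le => //; first exact: cD.
  by move=> t /hP; rewrite ler_norml => /andP[_]; lra.
have h2 : oint (fun t => P x t + (k * u - w)) y (y + v) <= oint (P (x + u)) y (y + v).
  apply: oint_le => //; first exact: cD.
  by move=> t /hP; rewrite ler_norml => /andP[+ _]; lra.
have h3 : oint (Q^~ (y + v)) x (x + u) <= oint (fun t => Q t y + (k * v + w)) x (x + u).
  apply: oint_le => //; first exact: cD.
  by move=> t /hQ; rewrite ler_norml => /andP[_]; lra.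
have h4 : oint (fun t => Q t y + (k * v - w)) x (x + u) <= oint (Q^~ (y + v)) x (x + u).
  apply: oint_le => //; first exact: cD.
  by move=> t /hQ; rewrite ler_norml => /andP[+ _]; lra.
rewrite !ointD ?oint_cst // in h1 h2 h3 h4.
by rewrite /flux ler_norml; apply/andP; split; lra.
Qed.

Hypothesis cP : forall x, continuous (P x).
Hypothesis cQ : forall y, continuous (Q^~ y).

(* Goursat's bisection: [px] is at once the x-derivative of [P] and the
   y-derivative of [Q], so the field has zero divergence. *)
Lemma goursat a c u v : 0 < u -> 0 < v ->
  (forall x y, a <= x <= a + u -> c <= y <= c + v -> exists px py qx,
    forall e, 0 < e -> exists2 d, 0 < d &
    forall x' y', a <= x' <= a + u -> c <= y' <= c + v ->
      `|x' - x| <= d -> `|y' - y| <= d ->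
      `|P x' y' - P x y - (px * (x' - x) + py * (y' - y))|
        <= e * (`|x' - x| + `|y' - y|) /\
      `|Q x' y' - Q x y - (qx * (x' - x) + px * (y' - y))|
        <= e * (`|x' - x| + `|y' - y|)) ->
  flux a c u v = 0.
Proof.
move=> u0 v0 dPQ; apply/eqP; rewrite -normr_le0 leNgt; apply/negP => m0.
set m := `|flux a c u v| in m0.
pose U n := u / 2 ^+ n; pose V n := v / 2 ^+ n.
have p2 n : 0 < (2 : R) ^+ n by rewrite exprn_gt0.
have U0 n : 0 < U n by rewrite divr_gt0.
have V0 n : 0 < V n by rewrite divr_gt0.
have US n : U n = U n.+1 + U n.+1.
  by rewrite /U exprS; field; rewrite expf_neq0.
have VS n : V n = V n.+1 + V n.+1.
  by rewrite /V exprS; field; rewrite expf_neq0.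
pose bad (n : nat) (p : R * R) := m / 4 ^+ n <= `|flux p.1 p.2 (U n) (V n)|.
pose sub (n : nat) (p q : R * R) :=
  [/\ p.1 <= q.1, q.1 + U n.+1 <= p.1 + U n, p.2 <= q.2 & q.2 + V n.+1 <= p.2 + V n].
(* Badness is a premise inside the existential, so that [choice] yields a total function on all
   pairs. *)
have step (np : nat * (R * R)) : exists q,
    bad np.1 np.2 -> bad np.1.+1 q /\ sub np.1 np.2 q.
  case: np => n [x y] /=.
  have m4 : m / 4 ^+ n = m / 4 ^+ n.+1 * 4.
    by rewrite exprS; field; rewrite expf_neq0.
  have un := U0 n.+1; have vn := V0 n.+1.
  pose pts := [:: (x, y); (x + U n.+1, y); (x, y + V n.+1); (x + U n.+1, y + V n.+1)].
  have [/hasP[q qin qbad]|/hasPn nb] := boolP (has (fun q =>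
      m / 4 ^+ n.+1 <= `|flux q.1 q.2 (U n.+1) (V n.+1)|) pts).
    exists q => _; split => //.
    have := US n; have := VS n; rewrite /sub.
    move: (U n) (U n.+1) (V n) (V n.+1) un vn @pts qin {qbad} => w w' z z' w0 z0 pts qin zz ww.
    by move: qin; rewrite !inE => /or4P[] /eqP -> /=; split; lra.
  exists (x, y); rewrite /bad /= US VS flux_quarters m4 => h; exfalso.
  have l q : q \in pts -> `|flux q.1 q.2 (U n.+1) (V n.+1)| < m / 4 ^+ n.+1.
    by move=> /nb; rewrite -ltNge.
  have := l (x, y); rewrite !inE eqxx /= => /(_ isT) l1.
  have := l (x + U n.+1, y); rewrite !inE eqxx !orbT /= => /(_ isT) l2.
  have := l (x, y + V n.+1); rewrite !inE eqxx !orbT /= => /(_ isT) l3.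
  have := l (x + U n.+1, y + V n.+1); rewrite !inE eqxx !orbT /= => /(_ isT) l4.
  move: h l1 l2 l3 l4; set f1 := flux _ _ _ _; set f2 := flux _ _ _ _.
  set f3 := flux _ _ _ _; set f4 := flux _ _ _ _ => h l1 l2 l3 l4.
  have := ler_normD (f1 + f2 + f3) f4; have := ler_normD (f1 + f2) f3.
  have := ler_normD f1 f2; lra.
have [next nextP] := choice step.
pose s := fix s n := if n is k.+1 then next (k, s k) else (a, c).
have sbad n : bad n (s n).
  elim: n => [|n IH]; first by rewrite /bad /= /U /V !expr0 !divr1.
  by have [] := nextP (n, s n) IH.
have ssub n : sub n (s n) (s n.+1) by have [] := nextP (n, s n) (sbad n).
have smon n k : [/\ (s n).1 <= (s (n + k)%N).1,
    (s (n + k)%N).1 + U (n + k)%N <= (s n).1 + U n,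
    (s n).2 <= (s (n + k)%N).2 & (s (n + k)%N).2 + V (n + k)%N <= (s n).2 + V n].
  elim: k => [|k [h1 h2 h3 h4]]; first by rewrite addn0.
  have [g1 g2 g3 g4] := ssub (n + k)%N.
  by rewrite addnS; split; lra.
have sle n k : (s n).1 <= (s k).1 + U k /\ (s n).2 <= (s k).2 + V k.
  have [nk|/ltnW kn] := leqP n k.
  - have [h1 h2 h3 h4] := smon n (k - n)%N; rewrite subnKC // in h1 h2 h3 h4.
    by have := U0 k; have := V0 k; split; lra.
  - have [h1 h2 h3 h4] := smon k (n - k)%N; rewrite subnKC // in h1 h2 h3 h4.
    by have := U0 n; have := V0 n; split; lra.
(* By [sle] every lower corner lies below every upper corner, so the suprema of the lower corners
   give a point common to all the rectangles. *)
pose xs := sup [set (s n).1 | n in setT]; pose ys := sup [set (s n).2 | n in setT].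
have xsP n : (s n).1 <= xs <= (s n).1 + U n.
  apply/andP; split.
  - by apply: ub_le_sup; [exists ((s 0%N).1 + U 0%N) => _ [k _ <-]; have [] := sle k 0%N|exists n].
  - by apply: ge_sup; [exists (s 0%N).1; exists 0%N|move=> _ [k _ <-]; have [] := sle k n].
have ysP n : (s n).2 <= ys <= (s n).2 + V n.
  apply/andP; split.
  - by apply: ub_le_sup; [exists ((s 0%N).2 + V 0%N) => _ [k _ <-]; have [] := sle k 0%N|exists n].
  - by apply: ge_sup; [exists (s 0%N).2; exists 0%N|move=> _ [k _ <-]; have [] := sle k n].
have U00 : U 0%N = u by rewrite /U expr0 divr1.
have V00 : V 0%N = v by rewrite /V expr0 divr1.
have := xsP 0%N; have := ysP 0%N; rewrite /= U00 V00 => yin xin.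
have [px [py [qx /(_ (m / (4 * (u + v) ^+ 2)))]]] := dPQ _ _ xin yin.
have uv0 : 0 < u + v by exact: addr_gt0.
(* With this tolerance the final bound [(w + w) * (U n + V n)] is half of [m / 4 ^+ n], against
   badness. *)
have e0 : 0 < m / (4 * (u + v) ^+ 2) by rewrite divr_gt0 // mulr_gt0 // exprn_gt0.
move=> /(_ e0) [d d0 hd].
have [n nd] : exists n, (u + v) / 2 ^+ n <= d.
  exists (Num.bound ((u + v) / d)); rewrite ler_pdivrMr // mulrC -ler_pdivrMr //.
  have /archi_boundP/ltW/le_trans := ltW (divr_gt0 uv0 d0); apply.
  by rewrite -natrX ler_nat ltnW // ltn_expl.
have [h1 h2 h3 h4] := smon 0%N n; rewrite /= add0n U00 V00 in h1 h2 h3 h4.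
have /andP[x1 x2] := xsP n; have /andP[y1 y2] := ysP n.
have un := U0 n; have vn := V0 n; have sb := sbad n.
have unv : U n + V n = (u + v) / 2 ^+ n by rewrite /U /V -mulrDl.
move: h1 h2 h3 h4 x1 x2 y1 y2 sb; rewrite /bad; case: (s n) => x y /=.
move=> h1 h2 h3 h4 x1 x2 y1 y2.
apply/negP; rewrite -ltNge.
set e := m / _ in e0 hd.
set w := e * (U n + V n).
have w0 : 0 < e by [].
have close x' y' : x <= x' <= x + U n -> y <= y' <= y + V n ->
  `|P x' y' - P xs ys - (px * (x' - xs) + py * (y' - ys))| <= w /\
  `|Q x' y' - Q xs ys - (qx * (x' - xs) + px * (y' - ys))| <= w.
  move=> hx hy.
  have dx : `|x' - xs| <= U n by rewrite ler_norml; apply/andP; split; lra.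
  have dy : `|y' - ys| <= V n by rewrite ler_norml; apply/andP; split; lra.
  have bnd : e * (`|x' - xs| + `|y' - ys|) <= w by rewrite ler_pM2l // lerD.
  have [||||g1 g2] := hd x' y'; [lra..|].
  by split; [exact: le_trans bnd|exact: le_trans bnd].
have := @flux_le x y (U n) (V n) px (w + w) (ltW un) (ltW vn) (@cP x) (@cP _) (@cQ y) (@cQ _).
move=> /(_ _ _)/le_lt_trans; apply.
(* Two expansions at the same ordinate are subtracted: the [py] terms cancel and the errors add up
   to [w + w]. Likewise for [qx] below. *)
- move=> t ht.
  have [||+ _] := close (x + U n) t => //; first by lra.
  have [||+ _] := close x t => //; first by lra.
  by rewrite !ler_norml => /andP[? ?] /andP[? ?]; apply/andP; split; lra.
- move=> t ht.
  have [||_] := close t (y + V n) => //; first by lra.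
  have [||_] := close t y => //; first by lra.
  by rewrite !ler_norml => /andP[? ?] /andP[? ?]; apply/andP; split; lra.
have -> : (w + w) * (U n + V n) = m / 4 ^+ n / 2.
  rewrite /w unv /e.
  have -> : (4 : R) ^+ n = 2 ^+ n * 2 ^+ n by rewrite -exprMn -natrM.
  by field; rewrite !gt_eqF.
have : 0 < m / 4 ^+ n by rewrite divr_gt0 // exprn_gt0.
by move: (m / _) => z; lra.
Qed.

End Goursat.

(** * Norms over R[i] and the Hahn-Banach theorem *)

(** The norm as an element of [R]: [|x|] lives in [R[i]], which is only partially ordered and
    carries no real logarithm. *)
Definition nrm (R : realType) (E : normedModType R[i]) (x : E) : R := complex.Re `|x|.

Section Nrm.
Variables (R : realType) (E : normedModType R[i]).
Implicit Types (x y : E) (r : R) (a : R[i]).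

Lemma nrmE x : `|x| = (nrm x)%:C.
Proof. by rewrite /nrm RRe_real // normr_real. Qed.

Lemma nrm_ge0 x : 0 <= nrm x.
Proof. by rewrite -ler0c -nrmE. Qed.

Lemma nrm0 : nrm (0 : E) = 0.
Proof. by rewrite /nrm normr0. Qed.

Lemma nrm_eq0 x : nrm x = 0 -> x = 0.
Proof. by move=> x0; apply/eqP; rewrite -normr_eq0 nrmE x0. Qed.

Lemma nrmN x : nrm (- x) = nrm x.
Proof. by rewrite /nrm normrN. Qed.

Lemma nrmD x y : nrm (x + y) <= nrm x + nrm y.
Proof. by rewrite -lecR rmorphD /= -!nrmE ler_normD. Qed.

Lemma nrmZ a x : nrm (a *: x) = nrm (a : R[i]^o) * nrm x.
Proof.
apply: complexI; rewrite rmorphM /= -!nrmE.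
exact: normrZ.
Qed.

Lemma nrm_real r : nrm (r%:C : R[i]^o) = `|r|.
Proof. by rewrite /nrm normc_def /= expr0n addr0 sqrtr_sqr. Qed.

End Nrm.

Section NrmC.
Variable R : realType.
Implicit Types (a b : R[i]^o).

Lemma nrmM a b : nrm (a * b : R[i]^o) = nrm a * nrm b.
Proof. exact: (@nrmZ R R[i]^o). Qed.

Lemma Re_le_nrm a : `|complex.Re a| <= nrm a.
Proof. by rewrite -lecR -nrmE normc_ge_Re. Qed.

Lemma Im_le_nrm a : `|complex.Im a| <= nrm a.
Proof.
rewrite -lecR -nrmE normc_def lecR -sqrtr_sqr ler_wsqrtr //.
by rewrite lerDr sqr_ge0.
Qed.

Lemma nrm_le_ReIm a : nrm a <= `|complex.Re a| + `|complex.Im a|.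
Proof.
case: a => x y /=; have -> : (x +i* y) = x%:C + 'i * y%:C.
  by rewrite [LHS]complexE.
apply: le_trans (nrmD _ _) _; rewrite nrmM !nrm_real /=.
by rewrite {1}/nrm normc_def /= expr0n add0r expr1n sqrtr1 mul1r.
Qed.

Lemma nrm_sqr a : nrm a ^+ 2 = complex.Re a ^+ 2 + complex.Im a ^+ 2.
Proof. by rewrite /nrm normc_def /= sqr_sqrtr // addr_ge0 // sqr_ge0. Qed.

End NrmC.

Section HahnBanach.
Variables (R : realType) (E : normedModType R[i]).
Implicit Types (x y z : E) (r s t : R) (G : set (E * R)).

Let realcomb s (p : E * R) t (q : E * R) : E * R :=
  (s%:C *: p.1 + t%:C *: q.1, s * p.2 + t * q.2).

(** Partial functionals are encoded by their graphs, so that unions of chains need no gluing.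
    Domination makes a graph single-valued: the difference of two pairs over the same point lies
    over 0, where the second component is at most 0. *)
Let dominated G :=
  (forall p q s t, G p -> G q -> G (realcomb s p t q)) /\
  (forall p, G p -> p.2 <= nrm p.1).

Let line (p : E * R) : set (E * R) := [set (t%:C *: p.1, t * p.2) | t in setT].

Let line_dominated x : dominated (line (x, nrm x)).
Proof.
split=> [_ _ s t [u _ <-] [v _ <-]|_ [u _ <-]] /=.
- by exists (s * u + t * v) => //; rewrite /realcomb /= !scalerA -scalerDl
    rmorphD !rmorphM mulrDl !mulrA.
- by rewrite nrmZ nrm_real ler_wpM2r ?nrm_ge0 ?ler_norm.
Qed.

Let extend G (p : E * R) := [set realcomb 1 q.1 q.2 p | q in [set q : (E * R) * R | G q.1]].

Let extendE q t p : realcomb 1 q t p = (q.1 + t%:C *: p.1, q.2 + t * p.2).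
Proof. by rewrite /realcomb scale1r mul1r. Qed.

(** The value [r] at [y] must lie between all [q.2 - nrm (q.1 - y)] and all [nrm (p.1 + y) - p.2].
    The triangle inequality separates the two families, and homogeneity reduces multiples [t] of [y]
    to the cases of [y] and [- y]. *)
Let dominated_extend G y : dominated G -> (exists p, G p) ->
  exists r, dominated (extend G (y, r)).
Proof.
move=> [Gl Gn] [p0 Gp0].
pose S := [set q.2 - nrm (q.1 - y) | q in G].
have G1 p q s t : G p -> G q -> G (s%:C *: p.1 + t%:C *: q.1, s * p.2 + t * q.2).
  exact: Gl.
have ubS p : G p -> ubound S (nrm (p.1 + y) - p.2).
  move=> Gp _ [q Gq <-].
  have := Gn _ (G1 _ _ 1 1 Gp Gq); rewrite /= !scale1r !mul1r => h.
  have := nrmD (p.1 + y) (q.1 - y).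
  have -> : p.1 + y + (q.1 - y) = p.1 + q.1 by rewrite addrACA subrr addr0.
  by lra.
pose r := sup S; exists r.
have hS q : G q -> q.2 - nrm (q.1 - y) <= r.
  by move=> Gq; apply: ub_le_sup; [exists (nrm (p0.1 + y) - p0.2); exact: ubS|exists q].
have hS' p : G p -> r <= nrm (p.1 + y) - p.2.
  move=> Gp; apply: ge_sup; last exact: ubS.
  by exists (p0.2 - nrm (p0.1 - y)); exists p0.
split=> [_ _ s t [[p u] /= Gp <-] [[q v] /= Gq <-]|_ [[p t] /= Gp <-]]; rewrite !extendE /=.
- exists ((s%:C *: p.1 + t%:C *: q.1, s * p.2 + t * q.2), s * u + t * v) => /=.
    exact: G1.
  rewrite extendE /= /realcomb /= !scalerDr !scalerA rmorphD !rmorphM /= scalerDl.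
  by rewrite addrACA; congr (_, _); ring.
- have GZ k : G (k%:C *: p.1, k * p.2).
    by have := G1 _ _ k 0 Gp Gp; rewrite !scale0r !mul0r !addr0.
  have [t0|t0|->] := ltgtP t 0; last first.
  + by rewrite scale0r mul0r !addr0; exact: Gn.
  + have /= := hS' _ (GZ t^-1).
    have -> : p.1 + t%:C *: y = t%:C *: (t^-1%:C *: p.1 + y).
      by rewrite scalerDr scalerA -rmorphM /= divff ?gt_eqF // scale1r.
    rewrite nrmZ nrm_real gtr0_norm // => h.
    have := ler_wpM2l (ltW t0) h; rewrite mulrBr mulrA divff ?gt_eqF // mul1r; lra.
  + have /= := hS _ (GZ (- t)^-1).
    have -> : p.1 + t%:C *: y = (- t)%:C *: ((- t)^-1%:C *: p.1 - y).
      rewrite scalerBr scalerA -rmorphM /= divff ?oppr_eq0 ?lt_eqF // scale1r.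
      by rewrite rmorphN /= scaleNr opprK.
    rewrite nrmZ nrm_real gtr0_norm ?oppr_gt0 // => h.
    have Nt0 : 0 <= - t by rewrite oppr_ge0 ltW.
    have := ler_wpM2l Nt0 h; rewrite mulrBr mulrA divff ?oppr_eq0 ?lt_eqF // mul1r; lra.
Qed.

(** A maximal dominated graph containing [(x0, nrm x0)] is total, since otherwise it extends by one
    more vector. *)
Lemma hahn_banach_real x0 : exists L : E -> R,
  [/\ (forall x y, L (x + y) = L x + L y), (forall r x, L (r%:C *: x) = r * L x),
      (forall x, L x <= nrm x) & L x0 = nrm x0].
Proof.
(* [set0] is allowed because [Zorn_bigcup] also ranges over the empty chain. *)
pose P G := dominated G /\ (G = set0 \/ G (x0, nrm x0)).
have [A [[[Al An] Ax0] Amax]] : exists A, P A /\ forall B, A `<` B -> ~ P B.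
  apply: Zorn_bigcup => F FP Ftot; split.
    split=> [p q s t [X FX Xp] [Y FY Yq]|p [X FX Xp]].
    - have [XY|YX] := Ftot _ _ FX FY.
      + by exists Y => //; apply: (FP _ FY).1.1 => //; exact: XY.
      + by exists X => //; apply: (FP _ FX).1.1 => //; exact: YX.
    - exact: (FP _ FX).1.2.
  have [[X [FX Xx0]]|nX] := pselect (exists X, F X /\ X (x0, nrm x0)).
    by right; exists X.
  left; apply/seteqP; split=> // p [X FX Xp].
  have [_ [X0|Xx0]] := FP _ FX; first by rewrite X0 in Xp.
  by exfalso; apply: nX; exists X.
have Ahas : A (x0, nrm x0).
  case: Ax0 => // A0; exfalso; apply: (Amax (line (x0, nrm x0))).
    rewrite A0; split=> [|E0]; first exact: sub0set.
    by apply: (E0 (1%:C *: x0, 1 * nrm x0)); exists 1.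
  split; first exact: line_dominated.
  by right; exists 1; rewrite //= scale1r mul1r.
have Atot y : exists r, A (y, r).
  apply: contrapT => nA.
  have [|r dr] := @dominated_extend A y (conj Al An); first by exists (x0, nrm x0).
  have sA : A `<=` extend A (y, r).
    by move=> p Ap; exists (p, 0) => //=; rewrite extendE scale0r mul0r !addr0; case: p {Ap}.
  apply: (Amax (extend A (y, r))); last by split => //; right; exact: sA.
  split => // AE.
  have A00 : A (0, 0).
    by have := Al _ _ 0 0 Ahas Ahas; rewrite /realcomb !scale0r !mul0r !addr0.
  apply: nA; exists r; apply: AE; exists ((0, 0), 1) => //=.
  by rewrite extendE /= scale1r mul1r !add0r.
have Auniq y r r' : A (y, r) -> A (y, r') -> r = r'.
  suff H : forall r r', A (y, r) -> A (y, r') -> r <= r' by move=> h h'; apply/le_anti; rewrite !H.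
  move=> {}r {}r' h h'; have := An _ (Al _ _ 1 (-1) h h').
  by rewrite /= rmorphN /= !scaleN1r !scale1r subrr nrm0; lra.
have [L LA] := choice Atot.
exists L; split.
- move=> x y; apply: (Auniq (x + y)) => //.
  by have := Al _ _ 1 1 (LA x) (LA y); rewrite /realcomb /= !scale1r !mul1r.
- move=> r x; apply: (Auniq (r%:C *: x)) => //.
  by have := Al _ _ r 0 (LA x) (LA x); rewrite /realcomb /= !scale0r !mul0r !addr0.
- by move=> x; have := An _ (LA x).
- exact: (Auniq x0).
Qed.

(** The complexification [L x - i L (i x)] of a real functional [L]. For the norm bound, [x] is
    multiplied by a unit [u] making [phi (u *: x)] real and nonnegative, hence equal to
    [L (u *: x)]. At [x0] the real part already exhausts the norm, so the imaginary part
    vanishes. *)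
Lemma hahn_banach x0 : exists phi : E -> R[i]^o,
  [/\ (forall a x y, phi (a *: x + y) = a * phi x + phi y),
      (forall x, nrm (phi x) <= nrm x) & phi x0 = (nrm x0)%:C].
Proof.
have [L [LD LZ Ln Lx0]] := hahn_banach_real x0.
pose I : R[i] := 0 +i* 1.
have II : I * I = -1 by rewrite /I; simpc.
pose phi x : R[i]^o := L x +i* - L (I *: x).
have L0 : L 0 = 0 by have := LD 0 0; rewrite addr0; lra.
have LN x : L (- x) = - L x by have := LD x (- x); rewrite subrr L0; lra.
have phiD x y : phi (x + y) = phi x + phi y.
  by rewrite /phi scalerDr !LD opprD.
have LE (a : R[i]) u : L (a *: u) = complex.Re a * L u + complex.Im a * L (I *: u).
  have {1}-> : a = (complex.Re a)%:C + (complex.Im a)%:C * I.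
    by case: a => a b; rewrite /I; simpc.
  by rewrite scalerDl LD LZ -scalerA LZ.
have phiZ (a : R[i]) x : phi (a *: x) = a * phi x.
  have ii : I *: (I *: x) = - x by rewrite scalerA II scaleN1r.
  rewrite /phi (LE a x) scalerA (mulrC I) -scalerA (LE a) ii LN.
  by case: a => a b; apply/eqP; rewrite eq_complex /=; apply/andP; split; apply/eqP; ring.
have phin x : nrm (phi x) <= nrm x.
  have [p0|p0] := eqVneq (phi x) 0; first by rewrite p0 nrm0 nrm_ge0.
  have n0 : (nrm (phi x)) != 0 by apply: contra_neq p0; exact: nrm_eq0.
  pose u : R[i]^o := (nrm (phi x))%:C / phi x.
  have nu : nrm u = 1.
    have : nrm u * nrm (phi x) = nrm (phi x).
      by rewrite -nrmM /u divfK // nrm_real ger0_norm // nrm_ge0.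
    by move/(canRL (mulfK n0)); rewrite divff.
  have : phi (u *: x) = (nrm (phi x))%:C by rewrite phiZ /u divfK.
  move=> /(congr1 (@complex.Re R)) /= => <-.
  by have := Ln (u *: x); rewrite nrmZ nu mul1r.
exists phi; split => //.
- by move=> a x y; rewrite phiD phiZ.
- have ReP : complex.Re (phi x0) = nrm x0 by rewrite /= Lx0.
  have : complex.Im (phi x0) ^+ 2 <= 0.
    have := nrm_sqr (phi x0); rewrite ReP.
    have : nrm (phi x0) ^+ 2 <= nrm x0 ^+ 2 by rewrite lerXn2r ?nnegrE ?nrm_ge0.
    by lra.
  move=> ImP; have {}ImP : complex.Im (phi x0) = 0.
    by apply/eqP; rewrite -sqrf_eq0 eq_le ImP sqr_ge0.
  by apply/eqP; rewrite eq_complex /= Lx0 eqxx /=; apply/eqP.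
Qed.

End HahnBanach.

(** * The mean value property *)

Section ComplexContinuity.
Variables (R : realType) (E : normedModType R[i]).
Local Notation C := (R[i]^o).

Lemma closed_discE (z : C) : closed_disc z <-> nrm z <= 1.
Proof. by rewrite /closed_disc /= nrmE -(rmorph1 (real_complex R)) lecR. Qed.

Lemma gt0_complex (e : R[i]) : 0 < e -> exists2 r : R, 0 < r & e = r%:C.
Proof.
move=> e0; have er := RRe_real (gtr0_real e0).
by exists (complex.Re e); rewrite // -ltcR er.
Qed.

Lemma near_nrm (F : normedModType R[i]) (x : F) e : 0 < e ->
  \forall y \near x, nrm (x - y) <= e.
Proof.
move=> e0; have e0c : 0 < e%:C by rewrite ltcR.
near=> y; rewrite -lecR -nrmE; near: y.
exact: (@cvgrPdist_le _ _ _ _ _ (fun y : F => y) x).1.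
Unshelve. all: by end_near. Qed.

Lemma continuous_nrm : continuous (fun x : E => nrm x).
Proof.
move=> x; apply/(@cvgrPdist_le _ _ _ (nbhs x)) => e e0.
move: (near_nrm x e0); apply: filterS => y; apply: le_trans.
have := nrmD (x - y) y; have := nrmD (y - x) x; rewrite !subrK -(nrmN (y - x)) opprB.
by move=> h1 h2; rewrite ler_norml; apply/andP; split; lra.
Qed.

Lemma continuous_Re : continuous (fun x : C => complex.Re x).
Proof.
move=> x; apply/(@cvgrPdist_le _ _ _ (nbhs x)) => e e0.
move: (near_nrm x e0); apply: filterS => y; apply: le_trans.
by apply: le_trans (Re_le_nrm _); case: x y => [? ?] [? ?].
Qed.

Lemma continuous_Im : continuous (fun x : C => complex.Im x).
Proof.
move=> x; apply/(@cvgrPdist_le _ _ _ (nbhs x)) => e e0.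
move: (near_nrm x e0); apply: filterS => y; apply: le_trans.
by apply: le_trans (Im_le_nrm _); case: x y => [? ?] [? ?].
Qed.

Lemma continuous_complex (f g : R -> R) : continuous f -> continuous g ->
  continuous (fun t => (f t +i* g t) : C).
Proof.
move=> cf cg t; apply/cvgrPdist_le => e /gt0_complex[r r0 ->].
have r20 : 0 < r / 2 by rewrite divr_gt0.
have := cf t => /cvgrPdist_le/(_ _ r20) hf.
have := cg t => /cvgrPdist_le/(_ _ r20) hg.
near=> u; rewrite nrmE lecR; apply: le_trans (nrm_le_ReIm _) _ => /=.
have : `|f t - f u| <= r / 2 by near: u; exact: hf.
have : `|g t - g u| <= r / 2 by near: u; exact: hg.
lra.
Unshelve. all: by end_near. Qed.

Lemma continuous_circle_point : continuous (@circle_point R).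
Proof.
by apply: continuous_complex; [exact: continuous_cos|exact: continuous_sin].
Qed.

Lemma nrm_circle_point t : nrm (@circle_point R t) = 1.
Proof.
apply/eqP; rewrite -(@eqrXn2 _ 2) ?nrm_ge0 // nrm_sqr /= expr1n.
by rewrite cos2Dsin2.
Qed.

Lemma circle_pointD s t : @circle_point R (s + t) = circle_point s * circle_point t.
Proof.
rewrite /circle_point; simpc.
by rewrite cosD sinD [in sin s * cos t]mulrC [in X in _ +i* X]addrC.
Qed.

Lemma circle_point0 : @circle_point R 0 = 1.
Proof. by rewrite /circle_point cos0 sin0. Qed.

Lemma circle_pointD2pi t : @circle_point R (t + 2 * pi) = circle_point t.
Proof. by rewrite /circle_point mulr_natl cosD2pi sinD2pi. Qed.

Lemma derivable_expansion (h : C -> E) z : derivable h z 1 ->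
  exists d : E, forall e : R, 0 < e -> exists2 r : R, 0 < r &
    forall w, nrm (w - z) <= r ->
      nrm (h w - h z - (w - z) *: d) <= e * nrm (w - z).
Proof.
move=> /cvg_ex[d /= hd]; exists d => e e0.
have e0c : 0 < e%:C by rewrite ltcR.
move: hd => /cvgrPdist_le/(_ _ e0c)/=.
rewrite near_withinE => /nbhs_ballP[r /gt0_complex[r' r0 ->] hr].
exists (r' / 2); first by rewrite divr_gt0.
move=> w wz; have [->|wneq] := eqVneq w z.
  by rewrite !subrr scale0r subr0 nrm0 nrm0 mulr0.
have E1 : (w - z) *: (1 : C) = w - z by exact: mulr1.
have := hr (w - z); rewrite /= -ball_normE /= sub0r normrN !nrmE ltcR lecR E1 subrK.
have -> : (nrm (w - z) < r')%R by lra.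
rewrite subr_eq0 => /(_ isT wneq) {}hr.
have wz0 : w - z != 0 by rewrite subr_eq0.
have -> : h w - h z - (w - z) *: d = - ((w - z) *: (d - (w - z)^-1 *: (h w - h z))).
  by rewrite scalerBr opprB scalerA divff // scale1r.
by rewrite nrmN nrmZ mulrC ler_wpM2r // nrm_ge0.
Qed.

Lemma derivable_continuous_at (h : C -> E) z : derivable h z 1 -> {for z, continuous h}.
Proof. by move=> /derivable1_diffP/differentiable_continuous. Qed.

End ComplexContinuity.

Section MeanValue.
Variable R : realType.
Local Notation C := (R[i]^o).
Implicit Types (s t e : R).

Lemma is_derive_expansion (f : R -> R) (x d : R) : is_derive x 1 f d ->
  forall e, 0 < e -> exists2 r : R, 0 < r & forall u, `|u| <= r ->
    `|f (x + u) - f x - d * u| <= e * `|u|.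
Proof.
move=> [/cvg_ex[/= l hl] dE] e e0; have {dE} lE : l = d.
  by rewrite -dE; symmetry; apply/cvg_lim.
rewrite {l}lE in hl.
move: hl => /cvgrPdist_le/(_ _ e0)/=.
rewrite near_withinE => /nbhs_ballP[r /= r0 hr].
exists (r / 2); first by rewrite divr_gt0.
move=> u ur; have [->|u0] := eqVneq u 0.
  by rewrite addr0 subrr mulr0 subr0 normr0 mulr0.
have := hr u; rewrite /= -ball_normE /= sub0r normrN.
have -> : (`|u| < r)%R by lra.
rewrite -[u *: 1]/(u * 1) mulr1 (addrC u) -[_ *: _]/(u^-1 * _) => /(_ isT u0) {}hr.
have -> : f (x + u) - f x - d * u = - (u * (d - u^-1 * (f (x + u) - f x))).
  by field.
by rewrite normrN normrM mulrC ler_wpM2r.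
Qed.

(* [cexp s t] is [exp (s + i t)]. *)
Definition cexp s t : C := (expR s)%:C * circle_point t.

Lemma cexpD s t s' t' : cexp (s + s') (t + t') = cexp s t * cexp s' t'.
Proof. by rewrite /cexp expRD circle_pointD rmorphM /=; ring. Qed.

Lemma nrm_cexp s t : nrm (cexp s t) = expR s.
Proof. by rewrite nrmM nrm_circle_point nrm_real mulr1 gtr0_norm ?expR_gt0. Qed.

(** The addition formula pulls out the factor [cexp s t], leaving an expansion at the origin, which
    comes from those of [expR], [cos] and [sin] at 0. *)
Lemma cexp_expansion s t e : 0 < e -> exists2 r : R, 0 < r & forall s' t',
  `|s' - s| <= r -> `|t' - t| <= r ->
  nrm (cexp s' t' - cexp s t - ((s' - s) +i* (t' - t)) * cexp s t : C)
    <= e * (`|s' - s| + `|t' - t|).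
Proof.
move=> e0.
suff base k : 0 < k -> exists2 r : R, 0 < r & forall u v, `|u| <= r -> `|v| <= r ->
    nrm (cexp u v - 1 - (u +i* v) : C) <= k * (`|u| + `|v|).
  have [r r0 hr] := base (e / expR s) (divr_gt0 e0 (expR_gt0 s)).
  exists r => // s' t' hs ht.
  have := hr _ _ hs ht.
  have E : (cexp s' t' : C) = cexp s t * cexp (s' - s) (t' - t).
    by rewrite -cexpD !subrKC.
  have -> : cexp s' t' - cexp s t - ((s' - s) +i* (t' - t)) * cexp s t =
    cexp s t * (cexp (s' - s) (t' - t) - 1 - ((s' - s) +i* (t' - t))).
    by rewrite E; ring.
  rewrite nrmM nrm_cexp => h.
  have := ler_wpM2l (expR_ge0 s) h; rewrite mulrA mulrCA divff ?mulr1 //.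
  by rewrite gt_eqF ?expR_gt0.
move=> k0.
(* The errors below add up to [3 m |u| + 6 m |v|], so [m <= k / 8] suffices; [m <= 1] gives the
   crude bounds [eu] and [eu3]. *)
have k40 : 0 < Num.min (k / 8) 1 by rewrite lt_min ltr01 divr_gt0.
have [r1 r10 h1] := is_derive_expansion (is_derive_expR 0) k40.
have [r2 r20 h2] := is_derive_expansion (is_derive_cos 0) k40.
have [r3 r30 h3] := is_derive_expansion (is_derive_sin 0) k40.
set m := Num.min (k / 8) 1 in k40 h1 h2 h3.
have [m1 m2] : m <= 1 /\ m <= k / 8 by rewrite !ge_min !lexx orbT.
clearbody m.
exists (Num.min m (Num.min r1 (Num.min r2 r3))); first by rewrite !lt_min k40 r10 r20 r30.
move=> u v; rewrite !le_min => /and4P[um ur1 _ _] /and4P[vm _ vr2 vr3].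
have := h1 _ ur1; rewrite add0r expR0 mul1r => {}h1.
have := h2 _ vr2; rewrite add0r cos0 sin0 oppr0 mul0r subr0 => {}h2.
have := h3 _ vr3; rewrite add0r sin0 cos0 mul1r subr0 => {}h3.
have -> : cexp u v - 1 - (u +i* v) = (expR u * cos v - 1 - u) +i* (expR u * sin v - v) :> C.
  rewrite /cexp /circle_point; simpc.
  by apply/eqP; rewrite eq_complex /=; apply/andP; split; apply/eqP; ring.
apply: le_trans (nrm_le_ReIm _) _ => /=.
have eu : `|expR u - 1| <= 2 * `|u|.
  have -> : expR u - 1 = (expR u - 1 - u) + u by ring.
  apply: le_trans (ler_normD _ _) _.
  have : m * `|u| <= 1 * `|u| by rewrite ler_wpM2r.
  by lra.
have eu3 : `|expR u| <= 3.
  have -> : expR u = (expR u - 1) + 1 by ring.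
  by apply: le_trans (ler_normD _ _) _; rewrite normr1; lra.
have a1 : `|expR u * cos v - 1 - u| <= 3 * (m * `|v|) + m * `|u|.
  have -> : expR u * cos v - 1 - u = expR u * (cos v - 1) + (expR u - 1 - u) by ring.
  by apply: le_trans (ler_normD _ _) _; rewrite normrM lerD // ler_pM.
have a2 : `|expR u * sin v - v| <= 3 * (m * `|v|) + 2 * (m * `|u|).
  have -> : expR u * sin v - v = expR u * (sin v - v) + (expR u - 1) * v by ring.
  apply: le_trans (ler_normD _ _) _; rewrite !normrM.
  by apply: lerD; [rewrite ler_pM|rewrite (mulrC m) mulrA ler_pM].
have mu : m * `|u| <= k / 8 * `|u| by rewrite ler_wpM2r.
have mv : m * `|v| <= k / 8 * `|v| by rewrite ler_wpM2r.
have ku : 0 <= k * `|u| by rewrite mulr_ge0 // ltW.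
have kv : 0 <= k * `|v| by rewrite mulr_ge0 // ltW.
lra.
Qed.

Section Disc.
Variable h : C -> C.
Hypothesis dh : forall z, closed_disc z -> derivable h z 1.

(* The clamp makes [P] and [Q] continuous on the whole plane. *)
Let cl s := Num.min s 0.

Let cexp_disc s t : closed_disc (cexp (cl s) t).
Proof. by apply/closed_discE; rewrite nrm_cexp -expR0 ler_expR ge_min lexx orbT. Qed.

Let P s t := complex.Re (h (cexp (cl s) t)).
Let Q s t := complex.Im (h (cexp (cl s) t)).

Let continuous_cexp_t s : continuous (cexp s).
Proof.
have -> : cexp s = (fun t => (expR s * cos t) +i* (expR s * sin t)).
  by apply/funext => t; rewrite /cexp /circle_point; simpc.
by apply: continuous_complex => t; apply: cvgMr; [exact: continuous_cos|exact: continuous_sin].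
Qed.

Let continuous_cexp_s t : continuous (fun s => cexp (cl s) t).
Proof.
have -> : (fun s => cexp (cl s) t) = (fun s => (expR (cl s) * cos t) +i* (expR (cl s) * sin t)).
  by apply/funext => s; rewrite /cexp /circle_point; simpc.
have ce : continuous (fun s => expR (cl s)).
  move=> s; apply: (@continuous_comp _ _ _ cl expR); last exact: continuous_expR.
  by apply: continuous_min; [exact: cvg_id|exact: cvg_cst].
by apply: continuous_complex => s; apply: cvgMl; exact: ce.
Qed.

Let cP s : continuous (P s).
Proof.
move=> t; apply: (@continuous_comp _ _ _ (fun t => h (cexp (cl s) t))
  (@complex.Re R : C -> R)); last exact: continuous_Re.
apply: (@continuous_comp _ _ _ (cexp (cl s)) h); first exact: continuous_cexp_t.
exact/derivable_continuous_at/dh.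
Qed.

Let cQ t : continuous (Q^~ t).
Proof.
move=> s; apply: (@continuous_comp _ _ _ (fun s => h (cexp (cl s) t))
  (@complex.Im R : C -> R)); last exact: continuous_Im.
apply: (@continuous_comp _ _ _ (fun s => cexp (cl s) t) h); first exact: continuous_cexp_s.
exact/derivable_continuous_at/dh.
Qed.

(** Zero flux through [[s, 0] x [0, 2 pi]]: the horizontal sides carry the same [Q] by periodicity,
    so the two vertical ones, which are circles of radii [expR s] and 1, have equal means. *)
Let mean_const s : s < 0 -> oint (P 0) 0 (2 * pi) = oint (P s) 0 (2 * pi).
Proof.
move=> s0; have Ns : 0 < - s by rewrite oppr_gt0.
have pi2 : (0 : R) < 2 * pi by rewrite mulr_gt0 // pi_gt0.
have := @goursat R P Q cP cQ s 0 (- s) (2 * pi) Ns pi2.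
rewrite /flux subrr !add0r.
have -> : Q^~ (2 * pi) = Q^~ 0.
  by apply/funext => x; rewrite /Q /cexp -{1}[2 * pi]add0r circle_pointD2pi.
move=> H; apply/eqP; rewrite -subr_eq0; apply/eqP.
move: H; rewrite subrr subr0; apply.
move=> x y /andP[sx x0] _.
have clx z : z <= 0 -> cl z = z by move=> z0; apply/min_idPl.
have [d hd] := derivable_expansion (dh (cexp_disc x y)).
rewrite clx // in hd.
(* The derivative of [h (exp w)] by the chain rule. Its real and imaginary parts are the partial
   derivatives of [P] and [Q], linked by the Cauchy-Riemann equations. *)
pose D := cexp x y * d.
exists (complex.Re D), (- complex.Im D), (complex.Im D) => e e0.
have c0 : 0 < nrm d + 3 by have := nrm_ge0 d; lra.
(* The expansion of [h] costs [2 k D1] and that of the exponential [k D1 nrm d]. The bound [k <= 1]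
   gives [nrm (w' - w) <= 2 * D1], whence also the radius [r1 / 4]. *)
pose k := Num.min 1 (e / (nrm d + 3)).
have k0 : 0 < k by rewrite lt_min ltr01 divr_gt0.
have [k1 k2] : k <= 1 /\ k * (nrm d + 3) <= e.
  by rewrite -ler_pdivlMr // !ge_min !lexx orbT.
clearbody k.
have [r1 r10 h1] := hd _ k0.
have [r2 r20 h2] := cexp_expansion x y k0.
exists (Num.min (r1 / 4) r2); first by rewrite lt_min r20 divr_gt0.
move=> x' y' /andP[_ x'0] _.
rewrite !le_min => /andP[xr1 xr2] /andP[yr1 yr2].
have {}h2 := h2 _ _ xr2 yr2.
rewrite /P /Q !clx //.
set w := cexp x y in hd h1 h2 D *; set w' := cexp x' y' in h2 *.
set D1 := `|x' - x| + `|y' - y| in h2 *.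
have D10 : 0 <= D1 by rewrite addr_ge0.
pose Dl : C := (x' - x) +i* (y' - y); rewrite -/Dl in h2.
have nDl : nrm Dl <= D1 by exact: nrm_le_ReIm.
have nw : nrm w <= 1 by rewrite nrm_cexp -expR0 ler_expR.
have kD : k * D1 <= 1 * D1 by rewrite ler_wpM2r.
have nww : nrm (w' - w) <= 2 * D1.
  have -> : w' - w = (w' - w - Dl * w) + Dl * w by ring.
  apply: le_trans (nrmD _ _) _; rewrite nrmM.
  have : nrm Dl * nrm w <= D1 * 1 by rewrite ler_pM ?nrm_ge0.
  by lra.
have {}h1 : nrm (h w' - h w - (w' - w) * d) <= k * (2 * D1).
  apply: le_trans (h1 w' _) _; last by rewrite ler_wpM2l // ltW.
  by apply: le_trans nww _; rewrite /D1; lra.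
have key : nrm (h w' - h w - Dl * D) <= e * D1.
  have -> : h w' - h w - Dl * D = (h w' - h w - (w' - w) * d) + (w' - w - Dl * w) * d.
    by rewrite /D; ring.
  apply: le_trans (nrmD _ _) _; rewrite nrmM.
  have : nrm (w' - w - Dl * w) * nrm d <= k * D1 * nrm d by rewrite ler_wpM2r ?nrm_ge0.
  have : k * (nrm d + 3) * D1 <= e * D1 by rewrite ler_wpM2r.
  have : 0 <= k * D1 by rewrite mulr_ge0 // ltW.
  by lra.
split; apply: le_trans key.
- apply: le_trans (Re_le_nrm _); rewrite /Dl /D.
  case: (h w') (h w) (w * d) => [a1 b1] [a2 b2] [a3 b3] /=.
  by rewrite le_eqVlt; apply/orP; left; apply/eqP; congr `|_|; ring.
- apply: le_trans (Im_le_nrm _); rewrite /Dl /D.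
  case: (h w') (h w) (w * d) => [a1 b1] [a2 b2] [a3 b3] /=.
  by rewrite le_eqVlt; apply/orP; left; apply/eqP; congr `|_|; ring.
Qed.

(** The mean over the circle of radius [expR s] does not depend on [s] and, by continuity at 0,
    approaches [complex.Re (h 0)] as [s] tends to [-oo]. *)
Lemma mean_value_Re :
  oint (fun t => complex.Re (h (circle_point t))) 0 (2 * pi) = 2 * pi * complex.Re (h 0).
Proof.
have pi2 : (0 : R) < 2 * pi by rewrite mulr_gt0 // pi_gt0.
have -> : (fun t => complex.Re (h (circle_point t))) = P 0.
  by apply/funext => t; rewrite /P /cexp /cl minxx expR0 mul1r.
apply/eqP; rewrite -subr_eq0 -normr_le0; apply/ler_addgt0Pr => e e0; rewrite add0r.
have e'0 : 0 < e / (2 * pi) by exact: divr_gt0.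
have d0 : closed_disc (0 : C) by apply/closed_discE; rewrite nrm0 ler01.
have ch := derivable_continuous_at (dh d0).
have : \forall z \near (0 : C), nrm (h 0 - h z) <= e / (2 * pi).
  exact: (ch _ (near_nrm (h 0) e'0)).
move=> /nbhs_ballP[r /gt0_complex[r' r'0 ->] hr].
pose s := Num.min (-1) (ln (r' / 2)).
have s0 : s < 0 by rewrite gt_min ltrN10.
have sr : expR s < r'.
  have : expR s <= expR (ln (r' / 2)) by rewrite ler_expR ge_min lexx orbT.
  by rewrite lnK ?posrE ?divr_gt0 //; lra.
rewrite (mean_const s0).
have hP t : `|P s t - complex.Re (h 0)| <= e / (2 * pi).
  have : nrm (h 0 - h (cexp (cl s) t)) <= e / (2 * pi).
    apply: hr; rewrite -ball_normE /= sub0r normrN nrmE ltcR nrm_cexp.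
    by rewrite /cl (min_idPl (ltW s0)).
  apply: le_trans; rewrite -nrmN opprB; apply: le_trans (Re_le_nrm _).
  by rewrite /P; case: (h 0) (h _) => [? ?] [? ?].
have h1 : oint (P s) 0 (2 * pi) <= oint (fun=> complex.Re (h 0) + e / (2 * pi)) 0 (2 * pi).
  apply: oint_le; [exact: ltW|exact: cP|by move=> ?; exact: cvg_cst|].
  by move=> t _; have := hP t; rewrite ler_norml => /andP[_]; lra.
have h2 : oint (fun=> complex.Re (h 0) - e / (2 * pi)) 0 (2 * pi) <= oint (P s) 0 (2 * pi).
  apply: oint_le; [exact: ltW|by move=> ?; exact: cvg_cst|exact: cP|].
  by move=> t _; have := hP t; rewrite ler_norml => /andP[+ _]; lra.
have kE : e / (2 * pi) * (2 * pi) = e by rewrite divfK // gt_eqF.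
rewrite !oint_cst in h1 h2; move: (e / (2 * pi)) kE h1 h2 => k kE h1 h2.
by rewrite ler_norml; apply/andP; split; lra.
Qed.

Lemma continuous_on_circle : continuous (fun t => h (circle_point t)).
Proof.
move=> t; apply: (@continuous_comp _ _ _ (@circle_point R) h); first exact: continuous_circle_point.
by apply/derivable_continuous_at/dh/closed_discE; rewrite nrm_circle_point.
Qed.

End Disc.

End MeanValue.

(** * The maximum principle for scalar functions *)

Section MaximumPrinciple.
Variable R : realType.
Local Notation C := (R[i]^o).
Implicit Types (h g : C -> C) (z c : C).

Lemma derivable_mulC h g z : derivable h z 1 -> derivable g z 1 ->
  derivable (fun z => h z * g z) z 1.
Proof. by move=> dh dg; exact: (@derivableM R[i] C h g z 1 dh dg). Qed.

Lemma derivable_invC h z : derivable h z 1 -> h z != 0 ->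
  derivable (fun z => (h z)^-1) z 1.
Proof. by move=> dh hz; exact: (@derivableV R[i] C h z 1 hz dh). Qed.

Lemma derivable_compC (E : normedModType R[i]) h (g : C -> E) z :
  derivable h z 1 -> derivable g (h z) 1 -> derivable (fun z => g (h z)) z 1.
Proof.
move=> /derivable1_diffP dh /derivable1_diffP dg; apply/derivable1_diffP.
exact: (@differentiable_comp _ _ _ _ h g z dh dg).
Qed.

Lemma derivable_cstC c z : derivable (fun _ : C => c) z 1.
Proof. exact: derivable_cst. Qed.

Lemma derivable_affineC c (d : C) z : derivable (fun w : C => c * w + d : C) z 1.
Proof.
apply: (@derivableD R[i] C C (fun w => c * w) (fun=> d)); last exact: derivable_cstC.
exact: (@derivable_mulC (fun=> c) (fun w => w) z (@derivable_cstC c z) (@derivable_id R[i] C z 1)).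
Qed.

Lemma derivable_prodC (I : Type) (r : seq I) (h : I -> C -> C) z :
  (forall i, derivable (h i) z 1) -> derivable (fun z => \prod_(i <- r) h i z : C) z 1.
Proof.
move=> dh; elim: r => [|i r IH].
  by under eq_fun do rewrite big_nil; exact: derivable_cstC.
under eq_fun do rewrite big_cons.
exact: (@derivable_mulC (h i) (fun z => \prod_(j <- r) h j z : C) z (dh i) IH).
Qed.

Lemma rotate_to_norm z : exists2 c : C, nrm c = 1 & c * z = (nrm z)%:C.
Proof.
have [->|z0] := eqVneq z 0.
  by exists 1; rewrite ?mulr0 ?nrm0 // -(nrm_circle_point 0) circle_point0.
have n0 : nrm z != 0 by apply: contra_neq z0; exact: nrm_eq0.
exists ((nrm z)%:C / z); last by rewrite divfK.
apply: (mulIf n0); rewrite -nrmM divfK // nrm_real mul1r.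
by rewrite ger0_norm // nrm_ge0.
Qed.

(** After a rotation [h 0] is its own norm, so the mean value property of the real part bounds
    it. *)
Lemma maximum_principle h (M : R) :
  (forall z, closed_disc z -> derivable h z 1) ->
  (forall t, 0 <= t <= 2 * pi -> nrm (h (circle_point t)) <= M) -> nrm (h 0) <= M.
Proof.
move=> dh hM; have [c c1 cE] := rotate_to_norm (h 0).
have dch z : closed_disc z -> derivable (fun z => c * h z : C) z 1.
  by move=> /dh; exact: (@derivable_mulC (fun=> c) h z (@derivable_cstC c z)).
have pi2 : (0 : R) < 2 * pi by rewrite mulr_gt0 // pi_gt0.
rewrite -(ler_pM2l pi2); have <- : complex.Re (c * h 0) = nrm (h 0) by rewrite cE.
rewrite -(mean_value_Re dch).
have -> : 2 * pi * M = oint (fun=> M) 0 (2 * pi) by rewrite oint_cst subr0 mulrC.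
apply: oint_le; first exact: ltW.
- move=> t; apply: (@continuous_comp _ _ _ (fun t => c * h (circle_point t) : C)
    (@complex.Re R : C -> R)); last exact: continuous_Re.
  exact: (continuous_on_circle dch).
- by move=> ?; exact: cvg_cst.
- move=> t ht; apply: le_trans (ler_norm _) _; apply: le_trans (Re_le_nrm _) _.
  by rewrite nrmM c1 mul1r; exact: hM.
Qed.

End MaximumPrinciple.

(** * Subharmonicity of the logarithm of the modulus *)

Section Riemann.
Variable R : realType.
Implicit Types (f : R -> R) (a b e x y t : R).

Lemma segment_unif_continuous f a b e : continuous f -> 0 < e ->
  exists2 d, 0 < d & forall x y, a <= x <= b -> `|y - x| <= d -> `|f y - f x| <= e.
Proof.
move=> cf e0.
have /compact_near_coveringP/(_ R (nbhs (0 : R))) := @segment_compact R a b.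
move=> /(_ (fun d x => forall y, `|y - x| <= d -> `|f y - f x| <= e) _) H.
have {}H : \forall d \near (0 : R),
    `[a, b] `<=` (fun x => forall y, `|y - x| <= d -> `|f y - f x| <= e).
  apply: H => x _; have e20 : 0 < e / 2 by rewrite divr_gt0.
  have := cf x => /cvgrPdist_le/(_ _ e20)/nbhs_ballP[r /= r0 hr].
  exists (ball x (r / 2), ball (0 : R) (r / 2)) => /=.
    by split; apply: nbhsx_ballx; rewrite divr_gt0.
  move=> [x' d] /= []; rewrite -!ball_normE /= sub0r normrN => hx' hd y hy.
  have h1 : `|f x - f x'| <= e / 2 by apply: hr; rewrite -ball_normE /=; lra.
  have h2 : `|f x - f y| <= e / 2.
    apply: hr; rewrite -ball_normE /=.
    have -> : x - y = (x - x') - (y - x') by ring.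
    have := ler_normB (x - x') (y - x'); have := ler_norm d; lra.
  have -> : f y - f x' = (f x - f x') - (f x - f y) by ring.
  by have := ler_normB (f x - f x') (f x - f y); lra.
move: H => /nbhs_ballP[r /= r0 hr].
exists (r / 2); first by rewrite divr_gt0.
move=> x y xab; apply: (hr (r / 2)); last by rewrite /= in_itv.
by rewrite -ball_normE /= sub0r normrN gtr0_norm ?divr_gt0 //; lra.
Qed.

(** Each term is compared with the integral over the strip to its right; the [n] errors
    [e * (T / n)] add up to [e * T]. *)
Lemma riemann_sum_le f e T t n : continuous f -> 0 < T -> (0 < n)%N ->
  (forall x y, t <= x <= t + T -> `|y - x| <= T / n%:R -> `|f y - f x| <= e) ->
  T / n%:R * (\sum_(k < n) f (t + T / n%:R * k%:R)) <= oint f t (t + T) + e * T.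
Proof.
move=> cf T0 n0 uf; have nn0 : 0 < n%:R :> R by rewrite ltr0n.
set w := T / n%:R in uf *; have w0 : 0 < w by exact: divr_gt0.
have nw : w * n%:R = T by rewrite divfK // gt_eqF.
have H m : (m <= n)%N ->
  w * (\sum_(k < m) f (t + w * k%:R)) <= oint f t (t + w * m%:R) + e * (w * m%:R).
  elim: m => [_|m IH mn].
    by rewrite big_ord0 !mulr0 !addr0 /oint subrr.
  rewrite big_ord_recr /= mulrDr; have {}IH := IH (ltnW mn).
  have S : w * m.+1%:R = w * m%:R + w by rewrite -natr1; ring.
  have m0 : 0 <= w * m%:R by rewrite mulr_ge0 // ?ltW // ler0n.
  have mw : w * m%:R + w <= T by rewrite -S -nw ler_wpM2l ?ler_nat // ltW.
  have : oint (fun=> f (t + w * m%:R) - e) (t + w * m%:R) (t + (w * m%:R + w)) <=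
         oint f (t + w * m%:R) (t + (w * m%:R + w)).
    apply: oint_le => //; first by rewrite addrA lerDl ltW.
      by move=> ?; exact: cvg_cst.
    move=> x /andP[x1 x2].
    have : `|f x - f (t + w * m%:R)| <= e.
      apply: uf; first by rewrite lerDl m0 lerD2l; lra.
      by rewrite ler_norml; apply/andP; split; lra.
    by rewrite ler_norml => /andP[]; lra.
  rewrite oint_cst -(oint_chasles f t (t + w * m%:R)) S => h.
  have -> : e * (w * m%:R + w) = e * (w * m%:R) + e * w by rewrite mulrDr.
  have E : (f (t + w * m%:R) - e) * (t + (w * m%:R + w) - (t + w * m%:R)) =
     w * f (t + w * m%:R) - e * w by ring.
  by rewrite E in h; lra.
by have := H n (leqnn n); rewrite nw.
Qed.

(** The product [H] takes the value [h 0 ^+ n] at 0. Taking logarithms and multiplying by the mesh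
    [w] removes the exponent, since [w * n = 2 pi]. *)
Lemma log_mean_le (h : R[i]^o -> R[i]^o) e :
  (forall z, closed_disc z -> derivable h z 1) -> h 0 != 0 -> 0 < e ->
  2 * pi * ln (nrm (h 0)) <= oint (fun t => ln (nrm (h (circle_point t)) + e)) 0 (2 * pi).
Proof.
move=> dh h0 e0; pose u t := ln (nrm (h (circle_point t)) + e); rewrite -/u.
have T0 : (0 : R) < 2 * pi by rewrite mulr_gt0 // pi_gt0.
have n0 : 0 < nrm (h 0).
  by rewrite lt_def nrm_ge0 andbT; apply: contra_neq h0; exact: nrm_eq0.
have pe t : 0 < nrm (h (circle_point t)) + e by rewrite ltr_wpDl // nrm_ge0.
have cu : continuous u.
  move=> t; apply: (@continuous_comp R R R (fun t => nrm (h (circle_point t)) + e) (@ln R)).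
    apply: cvgD; last exact: cvg_cst.
    apply: (@continuous_comp _ _ _ (fun t => h (circle_point t)) (@nrm R R[i]^o)).
      exact: continuous_on_circle.
    exact: continuous_nrm.
  exact: continuous_ln.
have uT t : u (t + 2 * pi) = u t by rewrite /u circle_pointD2pi.
apply/ler_addgt0Pr => k k0; have kT : 0 < k / (2 * pi) by exact: divr_gt0.
(* The sums start at any [t] in [[0, 2 pi]] and cover a full period, hence [4 * pi]. One [n] then
   serves all [t], with accumulated error [k]. *)
have [d d0 hd] := segment_unif_continuous 0 (4 * pi) cu kT.
pose n := (Num.bound (2 * pi / d)).+1.
have nn0 : 0 < n%:R :> R by rewrite ltr0n.
have nd : 2 * pi / n%:R <= d.
  rewrite ler_pdivrMr // (mulrC d) -ler_pdivrMr //.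
  have /archi_boundP/ltW/le_trans := ltW (divr_gt0 T0 d0); apply.
  by rewrite ler_nat leqnSn.
set w := 2 * pi / n%:R in nd.
have S t : 0 <= t <= 2 * pi ->
    w * (\sum_(j < n) u (t + w * j%:R)) <= oint u 0 (2 * pi) + k.
  move=> /andP[t0 t1].
  have := @riemann_sum_le u (k / (2 * pi)) (2 * pi) t n cu T0 isT.
  rewrite divfK ?gt_eqF // (oint_periodic t 0 cu uT) add0r; apply.
  move=> x y /andP[x1 x2] xy; apply: hd; last exact: le_trans nd.
  by apply/andP; split; lra.
pose H (z : R[i]^o) : R[i]^o := \prod_(j < n) h (circle_point (w * j%:R) * z).
have dH z : closed_disc z -> derivable H z 1.
  move=> dz; apply: derivable_prodC => j; apply: derivable_compC.
    have := @derivable_affineC R (circle_point (w * j%:R)) 0 z.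
    by under eq_fun do rewrite addr0.
  by apply/dh/closed_discE; rewrite nrmM nrm_circle_point mul1r; apply/closed_discE.
have nprod (F : 'I_n -> R[i]^o) : nrm (\prod_j F j : R[i]^o) = \prod_j nrm (F j).
  elim/big_ind2: _ => //; first by rewrite -circle_point0 nrm_circle_point.
  by move=> x1 x2 y1 y2 <- <-; rewrite nrmM.
pose M := expR ((oint u 0 (2 * pi) + k) / w).
have w0 : 0 < w by exact: divr_gt0.
have HM t : 0 <= t <= 2 * pi -> nrm (H (circle_point t)) <= M.
  move=> ht; rewrite /H nprod.
  apply: (@le_trans _ _ (\prod_(j < n) expR (u (t + w * j%:R)))).
    apply: ler_prod => j _; rewrite nrm_ge0 /= -circle_pointD addrC /u lnK ?posrE //.
    by rewrite lerDl ltW.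
  by rewrite -expR_sum ler_expR ler_pdivlMr // mulrC; exact: S.
have := maximum_principle dH HM.
rewrite /H nprod; under eq_bigr do rewrite mulr0.
rewrite prodr_const card_ord => hM.
have hl : ln (nrm (h 0) ^+ n) <= ln M by rewrite ler_ln ?posrE ?exprn_gt0 ?expR_gt0.
rewrite expRK lnXn // ler_pdivlMr // in hl.
have wn : w * n%:R = 2 * pi by rewrite /w divfK // gt_eqF.
have E : ln (nrm (h 0)) *+ n * w = 2 * pi * ln (nrm (h 0)).
  by rewrite -wn -[_ *+ n]mulr_natr; ring.
by rewrite E in hl.
Qed.

End Riemann.

(** * Moebius transformations of the disc *)

Section Moebius.
Variable R : realType.
Local Notation C := (R[i]^o).
Implicit Types (a z : C).

Definition mob a z : C := (z + a) / (1 + (conjc a : C) * z).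

Lemma mob0 a : mob a 0 = a.
Proof. by rewrite /mob add0r mulr0 addr0 divr1. Qed.

Lemma mob0l z : mob 0 z = z.
Proof. by rewrite /mob conjc0 mul0r !addr0 divr1. Qed.

Lemma nrm_conj a : nrm (conjc a : C) = nrm a.
Proof. by rewrite /nrm normcJ. Qed.

(** A positive real part, rather than mere nonvanishing, lets an arctangent serve as argument of the
    denominator on the circle. *)
Lemma mob_den a z : nrm a < 1 -> nrm z <= 1 -> 1 - nrm a <= complex.Re (1 + (conjc a : C) * z).
Proof.
move=> a1 z1.
have h : nrm ((conjc a : C) * z) <= nrm a.
  by rewrite nrmM nrm_conj -[leRHS]mulr1 ler_wpM2l ?nrm_ge0.
have := Re_le_nrm ((conjc a : C) * z).
rewrite ler_norml => /andP[h1 h2].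
have -> : complex.Re (1 + (conjc a : C) * z) = 1 + complex.Re ((conjc a : C) * z) by case: (_ * z).
lra.
Qed.

Lemma mob_den_neq0 a z : nrm a < 1 -> nrm z <= 1 -> 1 + (conjc a : C) * z != 0.
Proof.
by move=> a1 z1; have := mob_den a1 z1; apply: contraTneq => ->; rewrite -ltNge subr_gt0.
Qed.

(** The squared norms of denominator and numerator differ by [(1 - |a|^2) (1 - |z|^2)]. *)
Lemma mob_closed_disc a z : nrm a < 1 -> closed_disc z -> closed_disc (mob a z).
Proof.
move=> a1 /closed_discE z1; apply/closed_discE.
have D0 := mob_den_neq0 a1 z1.
have nD : 0 < nrm (1 + (conjc a : C) * z).
  by rewrite lt_def nrm_ge0 andbT; apply: contra_neq D0; exact: nrm_eq0.
have E : nrm (mob a z) * nrm (1 + (conjc a : C) * z) = nrm (z + a).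
  by rewrite -nrmM /mob divfK.
rewrite -(ler_pM2r nD) E mul1r -ler_sqr ?nnegrE ?nrm_ge0 //.
have az : 0 <= (1 - nrm a ^+ 2) * (1 - nrm z ^+ 2).
  rewrite mulr_ge0 // subr_ge0 -(expr1n _ 2) ler_sqr ?nnegrE ?nrm_ge0 //.
  exact: ltW.
move: az; rewrite !nrm_sqr; case: a {a1 D0 nD E} => a1 a2; case: z {z1} => z1 z2 /=.
lra.
Qed.

Lemma derivable_mob a z : nrm a < 1 -> closed_disc z -> derivable (mob a) z 1.
Proof.
move=> a1 /closed_discE z1.
apply: (@derivable_mulC R (fun z => z + a) (fun z => (1 + (conjc a : C) * z)^-1)).
  have := @derivable_affineC R 1 a z.
  by under eq_fun do rewrite mul1r.
apply: derivable_invC; last exact: mob_den_neq0.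
have := @derivable_affineC R (conjc a) 1 z.
by under eq_fun do rewrite addrC.
Qed.

End Moebius.

(** * Moebius maps on the circle and their Jacobian *)

Section MoebiusCircle.
Variables (R : realType) (a : R[i]^o).
Hypothesis a1 : nrm a < 1.
Local Notation C := (R[i]^o).
Implicit Types (t : R).

Let x := complex.Re a.
Let y := complex.Im a.
Let X t := 1 + x * cos t + y * sin t.
Let Y t := x * sin t - y * cos t.

Let denE t : 1 + (conjc a : C) * circle_point t = X t +i* Y t.
Proof.
rewrite /circle_point /X /Y /x /y; case: a => u v /=; simpc.
by apply/eqP; rewrite eq_complex /=; apply/andP; split; apply/eqP; ring.
Qed.

Let X_ge t : 1 - nrm a <= X t.
Proof.
have := @mob_den R a (circle_point t) a1; rewrite nrm_circle_point lexx => /(_ isT).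
by rewrite denE.
Qed.

Let X0 t : 0 < X t.
Proof. by apply: lt_le_trans (X_ge t); rewrite subr_gt0. Qed.

Let q t := Y t / X t.

(** On the circle [z + a] is [z] times the conjugate of the denominator, so [mob a] rotates [z] by
    minus twice the argument of the denominator [X t + i Y t]; as [X t > 0], this argument is
    [atan (Y t / X t)]. *)
Definition mob_angle t := t - 2 * atan (q t).

Let cos_atan2 (r : R) : cos (atan r) ^+ 2 = (1 + r ^+ 2)^-1.
Proof. by rewrite cos_atan exprVn sqr_sqrtr // addr_ge0 // sqr_ge0. Qed.

Let sin_atan (r : R) : sin (atan r) = r * cos (atan r).
Proof.
have c0 : cos (atan r) != 0.
  by rewrite -sqrf_eq0 cos_atan2 invr_eq0 gt_eqF // ltr_wpDr // sqr_ge0.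
by rewrite -{2}(atanK r) /tan divfK.
Qed.

Lemma mob_circle t : mob a (circle_point t) = circle_point (mob_angle t).
Proof.
have D0 : 1 + (conjc a : C) * circle_point t != 0.
  by apply: mob_den_neq0 => //; rewrite nrm_circle_point.
apply: (mulIf D0); rewrite /mob divfK // denE /mob_angle circle_pointD -mulrA.
have -> : circle_point (- (2 * atan (q t))) * (X t +i* Y t) = X t +i* - Y t :> C.
  have Xn : X t != 0 by rewrite gt_eqF.
  have r2 : 1 + q t ^+ 2 != 0 by rewrite gt_eqF // ltr_wpDr // sqr_ge0.
  rewrite /circle_point cosN sinN mulr_natl cos_mulr2n sin_mulr2n sin_atan.
  rewrite cos_atan2 mulrCA -expr2 cos_atan2.
  have -> : Y t = q t * X t by rewrite /q divfK.
  by simpc; apply/eqP; rewrite eq_complex /=; apply/andP; split; apply/eqP; field.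
rewrite /circle_point /X /Y.
have cs := cos2Dsin2 t.
have -> : a = x +i* y by rewrite /x /y; case: (a).
simpc; apply/eqP; rewrite eq_complex /=; apply/andP; split; apply/eqP.
- rewrite -[X in X + x]mulr1 -[X in _ + X]mulr1 -cs; ring.
- rewrite -[X in X + y]mulr1 -[X in _ + X]mulr1 -cs; ring.
Qed.

Let dX t : is_derive t 1 X (- Y t).
Proof.
have d1 := is_deriveZ x (is_derive_cos t); have d2 := is_deriveZ y (is_derive_sin t).
have := is_deriveD (is_deriveD (is_derive_cst (1 : R) t (1 : R)) d1) d2.
by move/is_derive_eq; apply; rewrite /Y /GRing.scale /=; ring.
Qed.

Let dY t : is_derive t 1 Y (X t - 1).
Proof.
have d1 := is_deriveZ x (is_derive_sin t); have d2 := is_deriveZ y (is_derive_cos t).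
have := is_deriveB d1 d2.
by move/is_derive_eq; apply; rewrite /X /GRing.scale /=; ring.
Qed.

(** The derivative of [mob_angle], a Poisson kernel. *)
Let ds t := (1 - nrm a ^+ 2) / (X t ^+ 2 + Y t ^+ 2).

Let den0 t : 0 < X t ^+ 2 + Y t ^+ 2.
Proof. by rewrite ltr_wpDr ?sqr_ge0 // exprn_gt0. Qed.

Let is_derive_mob_angle t : is_derive t 1 mob_angle (ds t).
Proof.
have Xn : X t != 0 by rewrite gt_eqF.
have dV : is_derive t 1 (fun t => (X t)^-1) (- (X t) ^- 2 *: - Y t).
  exact: is_deriveV.
have dq : is_derive t 1 q ((X t - 1) / X t + Y t ^+ 2 / X t ^+ 2).
  have := is_deriveM (dY t) dV.
  by move/is_derive_eq; apply; rewrite /GRing.scale /=; field.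
have := is_derive1_comp (is_derive1_atan (q t)) dq => da.
have := is_deriveB (is_derive_id t (1 : R)) (is_deriveZ (2 : R) da).
move/is_derive_eq; apply.
rewrite /GRing.scale /= /ds /q nrm_sqr -/x -/y.
(* The denominator minus 1 is [conjc a] times a unit, hence has norm [nrm a]. *)
have : (X t - 1) ^+ 2 + Y t ^+ 2 = (x ^+ 2 + y ^+ 2) * (cos t ^+ 2 + sin t ^+ 2).
  by rewrite /X /Y; ring.
rewrite cos2Dsin2 mulr1 => E.
have -> : 1 - (x ^+ 2 + y ^+ 2) = 2 * X t - X t ^+ 2 - Y t ^+ 2 by rewrite -E; ring.
by field; rewrite Xn gt_eqF.
Qed.

Let continuous_ds : continuous ds.
Proof.
have cX : continuous X.
  by move=> t; apply: differentiable_continuous; apply/derivable1_diffP; have [] := dX t.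
have cY : continuous Y.
  by move=> t; apply: differentiable_continuous; apply/derivable1_diffP; have [] := dY t.
move=> t; apply: cvgMr; apply: cvgV; first by rewrite gt_eqF.
by apply: cvgD; rewrite !expr2; apply: cvgM; [exact: cX|exact: cX|exact: cY|exact: cY].
Qed.

Let ds_le t : 0 <= ds t <= (1 - nrm a ^+ 2) / (1 - nrm a) ^+ 2.
Proof.
have a10 : 0 < 1 - nrm a by rewrite subr_gt0.
have a2 : 0 <= 1 - nrm a ^+ 2.
  by rewrite subr_ge0 -(expr1n _ 2) ler_sqr ?nnegrE ?nrm_ge0 // ltW.
rewrite /ds divr_ge0 // ?(ltW (den0 t)) //=.
rewrite ler_wpM2l // lef_pV2 ?posrE ?den0 ?exprn_gt0 //.
apply: (@le_trans _ _ (X t ^+ 2)); last by rewrite lerDl sqr_ge0.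
by rewrite ler_sqr ?nnegrE ?(ltW a10) ?(ltW (X0 t)).
Qed.

(** Substitution by [mob_angle], which advances by [2 pi] over a period. Since [V] is nonnegative on
    the circle, the Jacobian may be replaced by its upper bound. *)
Lemma oint_mob_ge (V : C -> R) :
  continuous (fun t => V (circle_point t)) -> (forall t, 0 <= V (circle_point t)) ->
  oint (fun t => V (circle_point t)) 0 (2 * pi) <=
  (1 - nrm a ^+ 2) / (1 - nrm a) ^+ 2 *
    oint (fun t => V (mob a (circle_point t))) 0 (2 * pi).
Proof.
move=> cV V0; pose v t := V (circle_point t); rewrite -/v.
have T0 : (0 : R) <= 2 * pi by rewrite mulr_ge0 // pi_ge0.
have vT t : v (t + 2 * pi) = v t by rewrite /v circle_pointD2pi.
have sT : mob_angle (2 * pi) = mob_angle 0 + 2 * pi.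
  have -> : mob_angle (2 * pi) = 2 * pi - 2 * atan (q 0).
    by rewrite /mob_angle /q /X /Y -[2 * pi]add0r mulr_natl cosD2pi sinD2pi.
  by rewrite /mob_angle; ring.
have cs : continuous mob_angle.
  by move=> t; apply: differentiable_continuous; apply/derivable1_diffP;
     have [] := is_derive_mob_angle t.
have cvs : continuous (fun t => v (mob_angle t)).
  by move=> t; apply: (@continuous_comp R R R mob_angle v); [exact: cs|exact: cV].
have {1}-> : oint v 0 (2 * pi) = oint v (mob_angle 0) (mob_angle (2 * pi)).
  by rewrite sT -[in LHS](add0r (2 * pi)); exact: oint_periodic.
rewrite -(oint_subst _ _ cV continuous_ds is_derive_mob_angle).
have -> : (fun t => V (mob a (circle_point t))) = (fun t => v (mob_angle t)).
  by apply/funext => t; rewrite mob_circle.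
rewrite -ointZ //; apply: oint_le => //.
- by move=> t; apply: cvgM; [exact: cvs|exact: continuous_ds].
- by move=> t; apply: cvgMr; exact: cvs.
- move=> t _; rewrite mulrC; apply: ler_wpM2r; first exact: V0.
  by have /andP[] := ds_le t.
Qed.

End MoebiusCircle.

(** * Vector-valued holomorphic maps *)

Section OintBump.
Variable R : realType.
Implicit Types (f : R -> R) (a b c t p q : R).

(** A quantitative form of strict positivity; an explicit gain can be carried through a limit. *)
Lemma oint_ge_bump f a b p q c : continuous f -> a <= p -> p <= q -> q <= b ->
  (forall t, a <= t <= b -> 0 <= f t) -> (forall t, p <= t <= q -> c <= f t) ->
  c * (q - p) <= oint f a b.
Proof.
move=> cf ap pq qb f0 fc.
have cst (k : R) : continuous (fun _ : R => k) by move=> ?; exact: cvg_cst.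
have h1 : oint (fun=> 0) a p <= oint f a p.
  by apply: oint_le => // t /andP[t1 t2]; apply: f0; lra.
have h2 : oint (fun=> c) p q <= oint f p q by exact: oint_le.
have h3 : oint (fun=> 0) q b <= oint f q b.
  by apply: oint_le => // t /andP[t1 t2]; apply: f0; lra.
rewrite !oint_cst !mul0r in h1 h2 h3.
by rewrite -(oint_chasles f a p) -(oint_chasles f p q); lra.
Qed.

(** The point [t] may be an end of the segment: a neighbourhood clipped to the segment still has
    positive length. *)
Lemma near_segment (P : R -> Prop) a b t : a < b -> a <= t <= b ->
  (\forall u \near t, P u) ->
  exists p q, [/\ a <= p, p < q, q <= b & forall u, p <= u <= q -> P u].
Proof.
move=> ab /andP[at_ tb] /nbhs_ballP[r /= r0 hr].
exists (Num.max a (t - r / 2)), (Num.min b (t + r / 2)).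
split; rewrite ?le_max ?ge_min ?lexx //.
- by rewrite gt_max !lt_min; apply/andP; split; apply/andP; split; lra.
- move=> u; rewrite ge_max le_min => /andP[/andP[_ u1] /andP[_ u2]].
  by apply: hr; rewrite -ball_normE /= ltr_norml; apply/andP; split; lra.
Qed.

Lemma circle_point_surj t : exists2 s, 0 <= s <= 2 * pi & circle_point s = circle_point t.
Proof.
have T0 : (0 : R) < 2 * pi by rewrite mulr_gt0 // pi_gt0.
have H n s : circle_point (s + 2 * pi * n%:R) = @circle_point R s.
  elim: n => [|n IH]; first by rewrite mulr0 addr0.
  have -> : s + 2 * pi * n.+1%:R = s + 2 * pi * n%:R + 2 * pi by rewrite -[n.+1%:R]natr1; ring.
  by rewrite circle_pointD2pi.
pose m := Num.floor (t / (2 * pi)).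
have := floor_itv (t / (2 * pi)); rewrite -/m => /andP[m1 m2].
exists (t - 2 * pi * m%:~R).
  rewrite subr_ge0 mulrC -ler_pdivlMr // m1 /= lerBlDr -[X in X + _]mul1r -mulrDl.
  by rewrite -ler_pdivrMr // addrC -[1]/(1%:~R) -intrD ltW.
case: m m1 m2 => n _ _.
- by rewrite -[in RHS](subrK (2 * pi * n%:R) t) H.
- by rewrite NegzE mulrNz mulrN opprK -pmulrn H.
Qed.

End OintBump.

Section VectorDisc.
Variables (R : realType) (E : normedModType R[i]).
Local Notation C := (R[i]^o).
Implicit Types (e t : R) (a z : C).

Lemma derivable_functional (phi : E -> C) (g : C -> E) z :
  (forall c x y, phi (c *: x + y) = c * phi x + phi y) ->
  (forall x, nrm (phi x) <= nrm x) ->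
  derivable g z 1 -> derivable (fun z => phi (g z)) z 1.
Proof.
move=> phil phin /cvg_ex[l /= hl]; apply/cvg_ex; exists (phi l) => /=.
have phi0 : phi 0 = 0.
  have := phil 1 0 0; rewrite scale1r addr0 mul1r => /eqP.
  by rewrite -subr_eq0 opprD addrA subrr sub0r oppr_eq0 => /eqP.
have phiZ (c : C) x : phi (c *: x) = c * phi x.
  by have := phil c x 0; rewrite !addr0 phi0 addr0.
have phiB x y : phi (x - y) = phi x - phi y.
  by have := phil (-1) y x; rewrite scaleN1r mulN1r addrC => ->; rewrite addrC.
have cphi : continuous phi.
  move=> x; apply/cvgrPdist_le => e /gt0_complex[r r0 ->].
  move: (near_nrm x r0); apply: filterS => y hy.
  by rewrite nrmE lecR -phiB; exact: le_trans (phin _) hy.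
have -> : (fun h : C => h^-1 *: (((fun z => phi (g z)) \o shift z) (h *: 1) - phi (g z))) =
  phi \o (fun h : C => h^-1 *: ((g \o shift z) (h *: 1) - g z)).
  by apply/funext => h /=; rewrite phiZ phiB.
apply: (cvg_comp _ _ hl); exact: cphi.
Qed.

Variable g : C -> E.
Hypothesis dg : forall z, closed_disc z -> derivable g z 1.

Lemma continuous_nrm_circle : continuous (fun t => nrm (g (circle_point t))).
Proof.
move=> t; apply: (@continuous_comp _ _ _ (fun t => g (circle_point t)) (@nrm R E)).
  apply: (@continuous_comp _ _ _ (@circle_point R) g); first exact: continuous_circle_point.
  by apply/derivable_continuous_at/dg/closed_discE; rewrite nrm_circle_point.
exact: continuous_nrm.
Qed.

Let dgmob a z : nrm a < 1 -> closed_disc z -> derivable (fun z => g (mob a z)) z 1.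
Proof.
move=> a1 dz; apply: derivable_compC; first exact: derivable_mob.
exact/dg/mob_closed_disc.
Qed.

(** A functional norming [g a] reduces this to the scalar function [phi (g (mob a z))], whose value
    at 0 has norm [nrm (g a)] and which is dominated by the norm of [g] on the circle. *)
Lemma log_mean_mob_le a e : nrm a < 1 -> g a != 0 -> 0 < e ->
  2 * pi * ln (nrm (g a)) <=
    oint (fun t => ln (nrm (g (mob a (circle_point t))) + e)) 0 (2 * pi).
Proof.
move=> a1 ga e0; have [phi [phil phin phia]] := hahn_banach (g a).
pose h z := phi (g (mob a z)).
have dh z : closed_disc z -> derivable h z 1.
  by move=> dz; apply: (derivable_functional phil phin); exact: dgmob.
have h0 : h 0 = (nrm (g a))%:C by rewrite /h mob0.
have n0 : nrm (g a) != 0 by apply: contra_neq ga; exact: nrm_eq0.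
have hn : nrm (h 0) = nrm (g a) by rewrite h0 nrm_real ger0_norm // nrm_ge0.
have h00 : h 0 != 0 by apply: contra_neq n0 => h00; rewrite -hn h00 nrm0.
have ch := continuous_on_circle dh.
have clog (F : normedModType R[i]) (f : R -> F) : continuous f ->
    continuous (fun t => ln (nrm (f t) + e)).
  move=> cf t; apply: (@continuous_comp R R R (fun t => nrm (f t) + e) (@ln R)).
    apply: cvgD; last exact: cvg_cst.
    by apply: (@continuous_comp _ _ _ f (@nrm R F)); [exact: cf|exact: continuous_nrm].
  by apply: continuous_ln; rewrite ltr_wpDl // nrm_ge0.
rewrite -hn; apply: le_trans (log_mean_le dh h00 e0) _.
apply: oint_le; [by rewrite mulr_ge0 // pi_ge0|exact: clog|apply: clog|].
- move=> t; apply: (@continuous_comp _ _ _ (@circle_point R) (fun z => g (mob a z))).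
    exact: continuous_circle_point.
  by apply/derivable_continuous_at/dgmob => //; apply/closed_discE; rewrite nrm_circle_point.
- move=> t _; rewrite ler_ln ?posrE ?ltr_wpDl ?nrm_ge0 // lerD2r.
  exact: phin.
Qed.

Lemma log_mean_le_vector e : g 0 != 0 -> 0 < e ->
  2 * pi * ln (nrm (g 0)) <= oint (fun t => ln (nrm (g (circle_point t)) + e)) 0 (2 * pi).
Proof.
move=> g0 e0; have := @log_mean_mob_le 0 e; rewrite nrm0 ltr01 => /(_ isT g0 e0).
by under eq_fun do rewrite mob0l.
Qed.

Lemma maximum_principle_vector a (M : R) : nrm a < 1 ->
  (forall t, nrm (g (circle_point t)) <= M) -> nrm (g a) <= M.
Proof.
move=> a1 gM; have [phi [phil phin phia]] := hahn_banach (g a).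
have := @maximum_principle R (fun z => phi (g (mob a z))) M.
rewrite mob0 phia nrm_real ger0_norm ?nrm_ge0 //; apply.
- by move=> z dz; apply: (derivable_functional phil phin); exact: dgmob.
- by move=> t _; rewrite mob_circle //; apply: le_trans (phin _) _.
Qed.

(** The Moebius maps reach only interior points as centres; boundary points are approached
    radially. *)
Lemma approx_interior z e : closed_disc z -> 0 < e ->
  exists2 a : C, nrm a < 1 & nrm (g z - g a) <= e.
Proof.
move=> dz e0; have := derivable_continuous_at (dg dz) => cg.
have : \forall w \near z, nrm (g z - g w) <= e by exact: (cg _ (near_nrm (g z) e0)).
move=> /nbhs_ballP[r /gt0_complex[r' r0 ->] hr].
pose s := Num.min 1 (r' / 2).
have s0 : 0 < s by rewrite lt_min ltr01 divr_gt0.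
have [s1 sr] : s <= 1 /\ s <= r' / 2 by rewrite !ge_min !lexx orbT.
move/closed_discE: dz => z1.
exists ((1 - s)%:C * z).
  rewrite nrmM nrm_real ger0_norm ?subr_ge0 //.
  have : (1 - s) * nrm z <= (1 - s) * 1 by rewrite ler_wpM2l // subr_ge0.
  by lra.
apply: hr; rewrite -ball_normE /=.
have -> : z - (1 - s)%:C * z = s%:C * z by rewrite rmorphB /=; ring.
rewrite nrmE ltcR nrmM nrm_real gtr0_norm //.
have : s * nrm z <= s * 1 by rewrite ler_wpM2l // ltW.
by lra.
Qed.

(* The bound is transported from the circle mean centred at [a], at the cost of
   the Moebius Jacobian. *)
Lemma log_mean_bounded_below : (exists2 z, closed_disc z & g z != 0) ->
  exists K : R, forall e, 0 < e -> e <= 1 ->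
    K <= oint (fun t => ln (nrm (g (circle_point t)) + e)) 0 (2 * pi).
Proof.
move=> [z dz gz].
have nz : 0 < nrm (g z).
  by rewrite lt_def nrm_ge0 andbT; apply: contra_neq gz; exact: nrm_eq0.
(* Within half the norm of [g z], the value at the interior point [a] cannot vanish. *)
have nz2 : 0 < nrm (g z) / 2 by rewrite divr_gt0.
have [a a1 ha] := approx_interior dz nz2.
have ga : g a != 0.
  by apply: contraTneq ha => ->; rewrite subr0 -ltNge; lra.
pose N t := nrm (g (circle_point t)).
have cN : continuous N by exact: continuous_nrm_circle.
have T0 : (0 : R) < 2 * pi by rewrite mulr_gt0 // pi_gt0.
have [B NB] : exists B, forall t, N t <= B.
  have [t0 _ Nt0] := EVT_max (ltW T0) (continuous_subspaceT cN).
  exists (N t0) => t; have [s hs st] := circle_point_surj t.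
  by rewrite /N -st; apply: Nt0; rewrite in_itv.
(* An upper bound of [ln (N t + e)] for all [e <= 1], making [V] below nonnegative on the circle. *)
pose L := ln (B + 1).
have NB0 : 0 <= B by apply: le_trans (NB 0); exact: nrm_ge0.
pose J := (1 - nrm a ^+ 2) / (1 - nrm a) ^+ 2.
have J0 : 0 <= J.
  rewrite divr_ge0 ?sqr_ge0 // subr_ge0 -(expr1n _ 2) ler_sqr ?nnegrE ?nrm_ge0 //.
  exact: ltW.
(* Solved from the chain [oint V <= J * oint (V o mob a) <= J * (2 pi L - 2 pi ln (nrm (g a)))],
   whose last term is free of [e]. *)
exists (L * (2 * pi) - J * (L * (2 * pi) - 2 * pi * ln (nrm (g a)))) => e e0 e1.
pose V (w : C) := L + (-1) * ln (nrm (g w) + e).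
have clog (f : R -> R) : continuous f -> (forall t, 0 <= f t) ->
    continuous (fun t => ln (f t + e)).
  move=> cf f0 t; apply: (@continuous_comp R R R (fun t => f t + e) (@ln R)).
    by apply: cvgD; [exact: cf|exact: cvg_cst].
  by apply: continuous_ln; rewrite ltr_wpDl.
have cst (k : R) : continuous (fun _ : R => k) by move=> ?; exact: cvg_cst.
have cu : continuous (fun t => ln (N t + e)) by apply: clog => // t; exact: nrm_ge0.
have cu' : continuous (fun t => ln (nrm (g (mob a (circle_point t))) + e)).
  apply: clog => [|t]; last exact: nrm_ge0.
  move=> t; apply: (@continuous_comp _ _ _ (fun t => g (mob a (circle_point t))) (@nrm R E)).
    apply: (@continuous_comp _ _ _ (@circle_point R) (fun z => g (mob a z))).
      exact: continuous_circle_point.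
    by apply/derivable_continuous_at/dgmob => //; apply/closed_discE; rewrite nrm_circle_point.
  exact: continuous_nrm.
have cV (f : R -> R) : continuous f -> continuous (fun t => -1 * f t).
  by move=> cf t; apply: cvgMr; exact: cf.
have NV : oint (fun t => V (circle_point t)) 0 (2 * pi) <=
    J * oint (fun t => V (mob a (circle_point t))) 0 (2 * pi).
  apply: oint_mob_ge => //.
    by move=> t; apply: cvgD; [exact: cst|exact: (cV _ cu)].
  move=> t; have h : nrm (g (circle_point t)) + e <= B + 1 by apply: lerD e1; exact: NB.
  have p0 : 0 < nrm (g (circle_point t)) + e by rewrite ltr_wpDl ?nrm_ge0.
  by rewrite /V mulN1r subr_ge0 ler_ln ?posrE // (lt_le_trans p0).
rewrite /V !ointD ?ointZ ?oint_cst // ?subr0 in NV;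
  try by [exact: (cV _ cu)|exact: (cV _ cu')|exact: cu|exact: cu'].
have : J * (L * (2 * pi) +
     -1 * oint (fun t => ln (nrm (g (mob a (circle_point t))) + e)) 0 (2 * pi))
   <= J * (L * (2 * pi) - 2 * pi * ln (nrm (g a))).
  by rewrite ler_wpM2l //; have := log_mean_mob_le a1 ga e0; lra.
lra.
Qed.

End VectorDisc.

(** * Maps of constant norm on the circle *)

Section Rigidity.
Variables (R : realType) (E : normedModType R[i]).
Local Notation C := (R[i]^o).
Variable g : C -> E.
Hypothesis dg : forall z, closed_disc z -> derivable g z 1.

(** The norming functional gives a scalar [h] bounded by [M] on the circle with [h 0 = M]. Equality
    in the mean forces [h = M] on the circle, hence inside, and there
    [M = nrm (h a) <= nrm (g a) <= M]. *)
Lemma sphere_rigidity : (forall t, nrm (g (circle_point t)) = nrm (g 0)) ->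
  forall z, closed_disc z -> nrm (g z) = nrm (g 0).
Proof.
move=> gM; set M := nrm (g 0) in gM *.
have T0 : (0 : R) < 2 * pi by rewrite mulr_gt0 // pi_gt0.
have [phi [phil phin phi0]] := hahn_banach (g 0); rewrite -/M in phi0.
pose h z := phi (g z).
have dh z : closed_disc z -> derivable h z 1.
  by move=> dz; apply: (derivable_functional phil phin); exact: dg.
pose f t := complex.Re (h (circle_point t)).
have cf : continuous f.
  move=> t; apply: (@continuous_comp _ _ _ (fun t => h (circle_point t))
    (@complex.Re R : C -> R)); last exact: continuous_Re.
  exact: continuous_on_circle.
have fM t : f t <= M.
  apply: le_trans (ler_norm _) _; apply: le_trans (Re_le_nrm _) _.
  by rewrite -(gM t); exact: phin.
(* [M - f] is nonnegative with zero integral over a period. The period is moved to start at [t],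
   where a positive value would leave a bump of positive integral. *)
have fE t : f t = M.
  apply/eqP; rewrite eq_le fM /= leNgt; apply/negP => fl.
  have d0 : 0 < (M - f t) / 2 by rewrite divr_gt0 // subr_gt0.
  have ft : f t < f t + (M - f t) / 2 by rewrite ltrDl.
  have tT : t <= t <= t + 2 * pi by rewrite lexx lerDl ltW.
  have near_f : \forall u \near t, f u < f t + (M - f t) / 2.
    exact: (cf t _ (lt_nbhsl ft)).
  have tlt : t < t + 2 * pi by rewrite ltrDl.
  have [p [q [tp pq qT hpq]]] := near_segment tlt tT near_f.
  have cMf : continuous (fun u => M + (-1) * f u).
    by move=> u; apply: cvgD; [exact: cvg_cst|apply: cvgMr; exact: cf].
  have := @oint_ge_bump R _ t (t + 2 * pi) p q ((M - f t) / 2) cMf tp (ltW pq) qT.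
  rewrite ointD ?ointZ //; last 2 first.
    by move=> u; exact: cvg_cst.
    by move=> u; apply: cvgMr; exact: cf.
  have fT u : f (u + 2 * pi) = f u by rewrite /f circle_pointD2pi.
  rewrite oint_cst (oint_periodic t 0 cf fT) add0r.
  have -> : oint f 0 (2 * pi) = 2 * pi * M by rewrite (mean_value_Re dh) /h phi0.
  have -> : M * (t + 2 * pi - t) + -1 * (2 * pi * M) = 0 by ring.
  move=> H; have {}H : (M - f t) / 2 * (q - p) <= 0.
    apply: H => [u _|u /hpq fu]; last by lra.
    by rewrite mulN1r subr_ge0.
  by move: H; rewrite leNgt mulr_gt0 // subr_gt0.
have hE t : h (circle_point t) = M%:C.
  have := nrm_sqr (h (circle_point t)); rewrite -/(f t) fE.
  have : nrm (h (circle_point t)) ^+ 2 <= M ^+ 2.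
    by rewrite ler_sqr ?nnegrE ?nrm_ge0 // -(gM t); exact: phin.
  move=> h1 h2; have h3 : complex.Im (h (circle_point t)) ^+ 2 <= 0 by lra.
  apply/eqP; rewrite eq_complex /= -/(f t) fE eqxx /=.
  by rewrite -sqrf_eq0 eq_le h3 sqr_ge0.
have interior a : nrm a < 1 -> nrm (g a) = M.
  move=> a1; apply/eqP; rewrite eq_le; apply/andP; split.
    by apply: (maximum_principle_vector dg) => // t; rewrite gM.
  (* This function vanishes on the circle, hence at 0, where its value is [h a - M]. *)
  pose k (z : C) : C := 1 * h (mob a z) + (- M%:C).
  have k0 : nrm (k 0) <= 0.
    apply: maximum_principle => [z dz|t _].
      apply: (@derivable_compC R C (fun z => h (mob a z)) (fun w => 1 * w + - M%:C)).
        apply: derivable_compC; first exact: derivable_mob.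
        exact/dh/mob_closed_disc.
      exact: derivable_affineC.
    by rewrite /k mob_circle // hE mul1r subrr nrm0.
  have : k 0 = 0 by apply: nrm_eq0; apply/le_anti; rewrite k0 nrm_ge0.
  rewrite /k mob0 mul1r => /eqP; rewrite subr_eq0 => /eqP hM.
  have <- : nrm (h a) = M by rewrite hM nrm_real ger0_norm // nrm_ge0.
  exact: phin.
move=> z dz; apply/eqP; rewrite -subr_eq0 -normr_le0; apply/ler_addgt0Pr => e e0.
rewrite add0r; have [a a1 ha] := approx_interior dg dz e0.
have := nrmD (g z - g a) (g a); have := nrmD (g a - g z) (g z).
rewrite !subrK -(nrmN (g a - g z)) opprB interior // => h1 h2.
by rewrite ler_norml; apply/andP; split; lra.
Qed.

End Rigidity.

(** * Strictly convex maps *)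

Section StrictlyConvex.
Variables (R : realType) (psi : \bar R -> \bar R).
Hypothesis hpsi : strictly_convex_map psi.
Local Notation p := (real_restriction psi).
Implicit Types (x y z r t : R).

Lemma psi_EFin r : psi r%:E = (p r)%:E.
Proof. by have [[_ _ h _] _] := hpsi; rewrite /real_restriction fineK. Qed.

Lemma psi_ltey (u : \bar R) : u != +oo%E -> (psi u < +oo)%E.
Proof. by have [[h _ _ _] _] := hpsi => u0; rewrite ltey; exact: (h u). Qed.

Lemma strictly_convex3 x y z : x < y -> y < z ->
  p y * (z - x) < (z - y) * p x + (y - x) * p z.
Proof.
move=> xy yz; have xz : 0 < z - x by lra.
have xzn : z - x != 0 by rewrite gt_eqF.
have [_ /(_ x z ((z - y) / (z - x)))] := hpsi.
have -> : (z - y) / (z - x) * x + (1 - (z - y) / (z - x)) * z = y by field.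
rewrite lt_eqF; last exact: lt_trans yz.
have t01 : 0 < (z - y) / (z - x) < 1.
  by apply/andP; split; [apply: divr_gt0; lra|rewrite ltr_pdivrMr // mul1r; lra].
move=> /(_ isT t01) h; rewrite -ltr_pdivlMr //; apply: lt_le_trans h _.
rewrite le_eqVlt; apply/orP; left; apply/eqP; by field.
Qed.

Lemma psi_within (u : \bar R) : u != +oo%E ->
  psi @ within (@ninfty_line R) (nbhs u) --> psi u.
Proof. by have [[_ /subspace_continuousP h _ _] _] := hpsi; exact: h. Qed.

Lemma psi_near_ninfty (a : \bar R) : (psi -oo < a)%E ->
  exists M, forall y, y < M -> ((p y)%:E < a)%E.
Proof.
move=> la; have /(_ _ (open_ereal_lt' la)) := @psi_within -oo%E isT.
move=> [M [Mreal hM]]; exists M => y yM.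
by rewrite -psi_EFin; apply: (hM y%:E) => //; rewrite lte_fin.
Qed.

Lemma psi_near_ninfty_gt (a : \bar R) : (a < psi -oo)%E ->
  exists M, forall y, y < M -> (a < (p y)%:E)%E.
Proof.
move=> la; have /(_ _ (open_ereal_gt' la)) := @psi_within -oo%E isT.
move=> [M [Mreal hM]]; exists M => y yM.
by rewrite -psi_EFin; apply: (hM y%:E) => //; rewrite lte_fin.
Qed.

Lemma continuous_real_restriction : continuous p.
Proof.
move=> r; have h : EFin @ nbhs r --> within (@ninfty_line R) (nbhs r%:E).
  move=> P hP; have {}hP : nbhs r (fun u => ninfty_line u%:E -> P u%:E) by exact: hP.
  by apply: filterS hP => u; apply.
have hp : psi \o EFin @ nbhs r --> (p r)%:E.
  by rewrite -psi_EFin; exact: (cvg_comp _ _ h (@psi_within r%:E isT)).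
exact: (fine_cvg hp).
Qed.

(** A descent somewhere would, by convexity, make [p] unbounded towards [-oo], whereas
    [psi -oo < +oo] and continuity bound it above there. *)
Lemma real_restriction_nd x y : x <= y -> p x <= p y.
Proof.
rewrite le_eqVlt => /predU1P[-> //|xy]; rewrite leNgt; apply/negP => pyx.
have [C hC] : exists C, (psi -oo < C%:E)%E.
  case: (psi -oo) (@psi_ltey -oo%E isT) => [r _| //|_].
  - by exists (r + 1); rewrite lte_fin ltrDl.
  - by exists 0; rewrite ltNyr.
have [M hM] := psi_near_ninfty hC.
pose c := `|C - p x|; have c0 : 0 <= c by exact: normr_ge0.
have hc : C <= p x + c by have := ler_norm (C - p x); rewrite -/c; lra.
pose d := (p x - p y) / (y - x).
have d0 : 0 < d by rewrite divr_gt0 // subr_gt0.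
(* So far left of [x], convexity gives [p z > p x + 2 + c], against [p z < C <= p x + c]. *)
pose z := Num.min (M - 1) (x - (2 + c) / d).
have zM : z < M by rewrite gt_min; apply/orP; left; lra.
have zx : x - z >= (2 + c) / d.
  have : z <= x - (2 + c) / d by rewrite ge_min lexx orbT.
  by lra.
have cd0 : 0 < (2 + c) / d by apply: divr_gt0; lra.
have zx0 : z < x by lra.
have := strictly_convex3 zx0 xy; have := hM z zM; rewrite lte_fin.
have xy0 : 0 < y - x by rewrite subr_gt0.
have dE : d * (y - x) = p x - p y by rewrite /d divfK // gt_eqF.
rewrite ler_pdivrMr // in zx.
have h : (2 + c) * (y - x) <= (x - z) * (p x - p y).
  by rewrite -dE mulrA ler_wpM2r // ltW.
move=> h1 h2; have {}h1 : p z < p x + c by lra.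
have : (y - x) * p z < (y - x) * (p x + c) by rewrite ltr_pM2l.
have : 0 <= c * (y - x) by rewrite mulr_ge0 // ltW.
lra.
Qed.

(** If [p x = p y], strict convexity would push the midpoint below [p x]. *)
Lemma real_restriction_incr x y : x < y -> p x < p y.
Proof.
move=> xy; have xm : x < (x + y) / 2 by lra.
have my : (x + y) / 2 < y by lra.
have := strictly_convex3 xm my; have := real_restriction_nd (ltW xm).
have := real_restriction_nd (ltW xy); rewrite le_eqVlt => /predU1P[<-|//].
have -> : (y - (x + y) / 2) * p x + ((x + y) / 2 - x) * p x = p x * (y - x) by ring.
by rewrite ltr_pM2r ?subr_gt0 //; lra.
Qed.

Lemma psi_ninfty_le y : (psi -oo <= (p y)%:E)%E.
Proof.
rewrite leNgt; apply/negP => /psi_near_ninfty_gt[M hM].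
have := hM (Num.min (M - 1) y); rewrite gt_min; have -> : M - 1 < M by lra.
move=> /(_ isT); rewrite lte_fin; apply/negP; rewrite -leNgt.
by apply: real_restriction_nd; rewrite ge_min lexx orbT.
Qed.

(** The slope is the supremum of the left slopes. The excess of [p] over the line is convex and
    vanishes at [x0], so beyond [x1] it is at least its value [k] at [x1]; this uniform gap is the
    source of all strict gains around [x0]. *)
Lemma support_line x0 : exists b : R, [/\ 0 < b,
  forall x, p x0 + b * (x - x0) <= p x
  & forall x1, x1 != x0 -> exists2 k : R, 0 < k &
      forall x, (x <= x1 < x0) || (x0 < x1 <= x) -> p x0 + b * (x - x0) + k <= p x].
Proof.
pose S := [set (p x0 - p x) / (x0 - x) | x in [set x | x < x0]].
have slope x z : x < x0 -> x0 < z ->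
    (p x0 - p x) / (x0 - x) <= (p z - p x0) / (z - x0).
  move=> xx0 x0z; rewrite ler_pdivrMr ?subr_gt0 // mulrAC ler_pdivlMr ?subr_gt0 //.
  by have := strictly_convex3 xx0 x0z; lra.
have ubS z : x0 < z -> ubound S ((p z - p x0) / (z - x0)).
  by move=> x0z _ [x xx0 <-]; exact: slope.
have x01 : x0 - 1 < x0 by lra.
have x02 : x0 < x0 + 1 by lra.
pose b := sup S.
have hS x : x < x0 -> (p x0 - p x) / (x0 - x) <= b.
  by move=> xx0; apply: ub_le_sup;
    [exists ((p (x0 + 1) - p x0) / (x0 + 1 - x0)); exact: ubS|exists x].
have hS' z : x0 < z -> b <= (p z - p x0) / (z - x0).
  move=> x0z; apply: ge_sup; last exact: ubS.
  by exists ((p x0 - p (x0 - 1)) / (x0 - (x0 - 1))); exists (x0 - 1).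
have b0 : 0 < b.
  apply: lt_le_trans (hS _ x01); rewrite divr_gt0 ?subr_gt0 //.
  exact: real_restriction_incr.
have sup_le x : p x0 + b * (x - x0) <= p x.
  have [xx0|x0x|->] := ltgtP x x0; last by rewrite subrr mulr0 addr0.
  - by have := hS _ xx0; rewrite ler_pdivrMr ?subr_gt0 //; lra.
  - by have := hS' _ x0x; rewrite ler_pdivlMr ?subr_gt0 //; lra.
exists b; split => // x1 x1n.
(* Strict convexity at the midpoint of [x0] and [x1], where the line lies weakly below [p]. *)
have k0 : 0 < p x1 - (p x0 + b * (x1 - x0)).
  have h := sup_le ((x1 + x0) / 2).
  have [x10|x01'|E] := ltgtP x1 x0; last by rewrite E eqxx in x1n.
  - have m1 : x1 < (x1 + x0) / 2 by lra.
    have m2 : (x1 + x0) / 2 < x0 by lra.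
    have := strictly_convex3 m1 m2.
    have -> : (x0 - (x1 + x0) / 2) * p x1 + ((x1 + x0) / 2 - x1) * p x0 =
      (p x1 + p x0) / 2 * (x0 - x1) by field.
    by rewrite ltr_pM2r ?subr_gt0 //; lra.
  - have m1 : x0 < (x1 + x0) / 2 by lra.
    have m2 : (x1 + x0) / 2 < x1 by lra.
    have := strictly_convex3 m1 m2.
    have -> : (x1 - (x1 + x0) / 2) * p x0 + ((x1 + x0) / 2 - x0) * p x1 =
      (p x1 + p x0) / 2 * (x1 - x0) by field.
    by rewrite ltr_pM2r ?subr_gt0 //; lra.
exists (p x1 - (p x0 + b * (x1 - x0))) => // x.
pose F y := p y - (p x0 + b * (y - x0)).
suff : (x <= x1 < x0) || (x0 < x1 <= x) -> F x1 <= F x by rewrite /F => h /h; lra.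
have Fx : 0 <= F x by rewrite subr_ge0.
have Fx1 : p x1 = F x1 + (p x0 + b * (x1 - x0)) by rewrite /F subrK.
have FE : p x = F x + (p x0 + b * (x - x0)) by rewrite /F subrK.
case/orP => /andP[]; [rewrite le_eqVlt => /predU1P[-> //|xx1] x10|
  move=> x10; rewrite le_eqVlt => /predU1P[-> //|x1x]].
- have := strictly_convex3 xx1 x10; rewrite Fx1 FE => h.
  have h1 : F x1 * (x0 - x) <= F x * (x0 - x1) by lra.
  have h2 : F x * (x0 - x1) <= F x * (x0 - x) by rewrite ler_wpM2l // lerD2l lerN2 ltW.
  by have := le_trans h1 h2; rewrite ler_pM2r // subr_gt0 (lt_trans xx1).
- have := strictly_convex3 x10 x1x; rewrite Fx1 FE => h.
  have h1 : F x1 * (x - x0) <= F x * (x1 - x0) by lra.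
  have h2 : F x * (x1 - x0) <= F x * (x - x0) by rewrite ler_wpM2l // lerD2r ltW.
  by have := le_trans h1 h2; rewrite ler_pM2r // subr_gt0 (lt_trans x10).
Qed.

Lemma psi_lne_gt0 r : 0 < r -> psi (lne r%:E) = (p (ln r))%:E.
Proof. by move=> r0; rewrite lne_EFin // psi_EFin. Qed.

Lemma lne_EFin_neqy r : lne r%:E != +oo%E.
Proof. by have [r0|r0] := ltP 0 r; [rewrite lne_EFin|rewrite le0_lneNy]. Qed.

(** Right semicontinuity in the norm, including at norm 0. With monotonicity it yields both upper
    semicontinuity on [E] and the limit of the regularised values. *)
Lemma psi_lne_right (a : \bar R) r : 0 <= r -> (psi (lne r%:E) < a)%E ->
  exists2 r', r < r' & (psi (lne r'%:E) < a)%E.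
Proof.
rewrite le_eqVlt => /predU1P[<-|r0].
  rewrite le0_lneNy // => /psi_near_ninfty[M hM].
  exists (expR (M - 1)); rewrite ?expR_gt0 // psi_lne_gt0 ?expR_gt0 // expRK.
  by apply: hM; lra.
rewrite psi_lne_gt0 // => la.
have : \forall y \near ln r, ((p y)%:E < a)%E.
  exact: (continuous_real_restriction (open_ereal_lt la)).
move=> /nbhs_ballP[d /= d0 hd].
have e0 : 0 < d / 2 by rewrite divr_gt0.
exists (expR (ln r + d / 2)).
  by rewrite -{1}(lnK r0) ltr_expR; lra.
rewrite psi_lne_gt0 ?expR_gt0 // expRK; apply: hd.
by rewrite -ball_normE /= opprD addrA subrr sub0r normrN gtr0_norm //; lra.
Qed.

Lemma psi_lne_nd r s : 0 <= r -> r <= s -> (psi (lne r%:E) <= psi (lne s%:E))%E.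
Proof.
rewrite le_eqVlt => /predU1P[<-|r0] rs.
  rewrite le0_lneNy //; have [s0|s0] := ltP 0 s; last by rewrite le0_lneNy.
  by rewrite psi_lne_gt0 //; exact: psi_ninfty_le.
have s0 := lt_le_trans r0 rs.
by rewrite !psi_lne_gt0 // lee_fin real_restriction_nd // ler_ln ?posrE.
Qed.

End StrictlyConvex.

(** * Circle means *)

Section MeanPsi.
Variables (R : realType) (psi : \bar R -> \bar R).
Hypothesis hpsi : strictly_convex_map psi.
Local Notation p := (real_restriction psi).
Local Notation mu := (@lebesgue_measure R).

Lemma cvg_psi_lne (r : R) : 0 <= r ->
  (fun n => psi (lne (r + n.+1%:R^-1)%:E)) @ \oo --> psi (lne r%:E).
Proof.
move=> r0; pose u n := psi (lne (r + n.+1%:R^-1)%:E); rewrite -/u.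
have e0 n : 0 < n.+1%:R^-1 :> R by rewrite invr_gt0 ltr0n.
have un : nonincreasing_seq u.
  move=> m n mn; apply: (psi_lne_nd hpsi); first by rewrite addr_ge0 // ltW.
  by rewrite lerD2l lef_pV2 ?posrE ?ltr0n // ler_nat.
suff <- : ereal_inf (range u) = psi (lne r%:E) by exact: ereal_nonincreasing_cvgn.
apply/eqP; rewrite eq_le; apply/andP; split; last first.
  apply: le_ereal_inf_tmp => _ [n _ <-]; apply: (psi_lne_nd hpsi) => //.
  by rewrite lerDl ltW.
rewrite leNgt; apply/negP => /(psi_lne_right hpsi r0)[r' rr' h].
have [n hn] : exists n, r + n.+1%:R^-1 <= r'.
  have rr0 : 0 < r' - r by rewrite subr_gt0.
  exists (Num.bound (r' - r)^-1); rewrite -lerBrDl -[leRHS]invrK lef_pV2 ?posrE ?ltr0n ?invr_gt0 //.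
  have /archi_boundP/ltW/le_trans : 0 <= (r' - r)^-1 by rewrite invr_ge0 ltW.
  by apply; rewrite ler_nat.
have : (ereal_inf (range u) <= u n)%E by apply: ereal_inf_lbound; exists n.
apply/negP; rewrite -ltNge; apply: le_lt_trans h.
by apply: (psi_lne_nd hpsi) => //; rewrite addr_ge0 // ltW.
Qed.

(** Monotone convergence is applied to [c - p (ln (N t + e n))], nonnegative because [e n <= 1] and
    nondecreasing in [n]. The limit [F] may take the value [+oo], but its integral is at most
    [c * T - K], so it is integrable and can be subtracted from [c] again. *)
Lemma integral_psi_ge (N : R -> R) (T K : R) : 0 < T -> continuous N -> (forall t, 0 <= N t) ->
  (forall e : R, 0 < e -> e <= 1 -> K <= oint (fun t => p (ln (N t + e))) 0 T) ->
  (K%:E <= \int[mu]_(t in `[0%R, T]) psi (lne (N t)%:E))%E.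
Proof.
move=> T0 cN N0 hK; pose D : set R := [set` `[0, T]].
have mD : measurable D by exact: measurable_itv.
have [B NB] : exists B, forall t, t \in `[0, T] -> N t <= B.
  have [t0 _ Nt0] := EVT_max (ltW T0) (continuous_subspaceT cN).
  by exists (N t0).
pose c := p (ln (B + 1)).
pose e n : R := n.+1%:R^-1.
have e0 n : 0 < e n by rewrite invr_gt0 ltr0n.
have e1 n : e n <= 1 by rewrite invf_le1 ?ltr0n // ler1n.
have pos n t : 0 < N t + e n by rewrite ltr_wpDl.
have cp n : continuous (fun t => p (ln (N t + e n))).
  move=> t; apply: (@continuous_comp R R R (fun t => ln (N t + e n)) p).
    apply: (@continuous_comp R R R (fun t => N t + e n) (@ln R)).
      by apply: cvgD; [exact: cN|exact: cvg_cst].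
    exact: continuous_ln.
  exact: (continuous_real_restriction hpsi).
pose G n t := c + (-1) * p (ln (N t + e n)).
have cG n : continuous (G n).
  by move=> t; apply: cvgD; [exact: cvg_cst|apply: cvgMr; exact: cp].
pose F t := (c%:E - psi (lne (N t)%:E))%E.
have GF t : (fun n => (G n t)%:E) @ \oo --> F t.
  have -> : (fun n => (G n t)%:E) = (fun n => c%:E - psi (lne (N t + n.+1%:R^-1)%:E))%E.
    by apply/funext => n; rewrite (psi_lne_gt0 hpsi (pos n t)) /G mulN1r EFinB.
  by apply: (cvgeB _ (cvg_cst _) (cvg_psi_lne (N0 t))); exact: fin_num_adde_defr.
have mG n : measurable_fun D (EFin \o G n).
  apply/measurable_EFinP; apply: measurable_funTS.
  exact: continuous_measurable_fun.
have mF : measurable_fun D F.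
  by apply: (emeasurable_fun_cvg (fun n => EFin \o G n)) => // t _; exact: GF.
have G0 n t : D t -> (0 <= (EFin \o G n) t)%E.
  move=> Dt; rewrite lee_fin /G mulN1r subr_ge0.
  have h : N t + e n <= B + 1 by apply: lerD; [exact: NB|exact: e1].
  apply: (real_restriction_nd hpsi); rewrite ler_ln ?posrE //.
  exact: lt_le_trans (pos n t) h.
have ndG t : D t -> nondecreasing_seq (fun n => (EFin \o G n) t).
  move=> Dt m n mn; rewrite lee_fin /G !mulN1r lerD2l lerN2.
  apply: (real_restriction_nd hpsi); rewrite ler_ln ?posrE // lerD2l.
  by rewrite lef_pV2 ?posrE ?ltr0n // ler_nat.
have IF : (\int[mu]_(t in D) F t <= (c * T - K)%:E)%E.
  have -> : (\int[mu]_(t in D) F t = \int[mu]_(t in D) limn (fun n => (EFin \o G n) t))%E.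
    by apply: eq_integral => t _; symmetry; apply/cvg_lim => //; exact: GF.
  rewrite monotone_convergence //.
  apply: lime_le.
    apply: ereal_nondecreasing_is_cvgn => m n mn; apply: ge0_le_integral => //.
    - by move=> t; exact: G0.
    - exact: mG.
    - exact: mG.
    - by move=> t Dt; exact: (ndG t Dt _ _ mn).
  apply: nearW => n; rewrite Rintegral_oint // lee_fin /G ointD ?ointZ ?oint_cst //; last 2 first.
    by move=> t; exact: cvg_cst.
    by move=> t; apply: cvgMr; exact: cp.
  by have := hK (e n) (e0 n) (e1 n); lra.
have F0 t : D t -> (0 <= F t)%E.
  by move=> Dt; apply: (cvge_to_ge (GF t)); apply: nearW => n; exact: G0.
have iF : mu.-integrable D F.
  apply/integrableP; split => //.
  under eq_integral => t /[!inE] Dt do rewrite gee0_abs ?F0 //.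
  by apply: le_lt_trans IF _; rewrite ltry.
have ic : mu.-integrable D (EFin \o cst c).
  by apply: continuous_integrable_itv => t; exact: cvg_cst.
have -> : (\int[mu]_(t in D) psi (lne (N t)%:E) = \int[mu]_(t in D) ((EFin \o cst c) \- F) t)%E.
  apply: eq_integral => t _; rewrite /F /=.
  have := psi_ltey hpsi (lne_EFin_neqy (N t)).
  case: (psi _) => [r _|//|_] //=.
  by rewrite -!EFinB opprB addrC subrK.
rewrite integralB // Rintegral_oint //; last by move=> t; exact: cvg_cst.
rewrite /cst oint_cst subr0.
have -> : K%:E = ((c * T)%:E - (c * T - K)%:E)%E by rewrite -EFinB opprB addrC subrK.
by rewrite leeB.
Qed.

End MeanPsi.

(** * Weak and strict mean value inequalities on the circle *)

Section SubMean.
Variables (R : realType) (psi : \bar R -> \bar R).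
Hypothesis hpsi : strictly_convex_map psi.
Local Notation p := (real_restriction psi).
Local Notation mu := (@lebesgue_measure R).

Lemma oint_ge_add (f l : R -> R) (a b q1 q2 k : R) : continuous f -> continuous l ->
  a <= q1 -> q1 <= q2 -> q2 <= b ->
  (forall t, a <= t <= b -> l t <= f t) -> (forall t, q1 <= t <= q2 -> l t + k <= f t) ->
  oint l a b + k * (q2 - q1) <= oint f a b.
Proof.
move=> cf cl aq qq qb lf lkf.
have cNl : continuous (fun t => (-1) * l t) by move=> t; apply: cvgMr; exact: cl.
have cd : continuous (fun t => f t + (-1) * l t).
  by move=> t; apply: cvgD; [exact: cf|exact: cNl].
have := @oint_ge_bump R _ a b q1 q2 k cd aq qq qb.
rewrite ointD // ointZ // => H.
suff : k * (q2 - q1) <= oint f a b + -1 * oint l a b by lra.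
by apply: H => t ht; [have := lf t ht; lra|have := lkf t ht; lra].
Qed.

Variables (E : normedModType R[i]) (g : R[i]^o -> E).
Hypothesis dg : forall z, closed_disc z -> derivable g z 1.

Let N t := nrm (g (circle_point t)).

Let cN : continuous N. Proof. exact: continuous_nrm_circle. Qed.
Let N0 t : 0 <= N t. Proof. exact: nrm_ge0. Qed.
Let T0 : (0 : R) < 2 * pi. Proof. by rewrite mulr_gt0 // pi_gt0. Qed.

Let cln (e : R) : 0 < e -> continuous (fun t => ln (N t + e)).
Proof.
move=> e0 t; apply: (@continuous_comp R R R (fun t => N t + e) (@ln R)).
  by apply: cvgD; [exact: cN|exact: cvg_cst].
by apply: continuous_ln; rewrite ltr_wpDl.
Qed.

Let cpln (e : R) : 0 < e -> continuous (fun t => p (ln (N t + e))).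
Proof.
move=> e0 t; apply: (@continuous_comp R R R (fun t => ln (N t + e)) p); first exact: cln.
exact: (continuous_real_restriction hpsi).
Qed.

(** Regularised means increase with [e], so a lower bound for small [e] already holds for all
    [e]. *)
Lemma circle_mean_psi_ge (K d : R) : 0 < d ->
  (forall e, 0 < e -> e <= d -> K <= oint (fun t => p (ln (N t + e))) 0 (2 * pi)) ->
  (((2 * pi)^-1 * K)%:E <= circle_mean (fun x => psi (log_norm x)) g)%E.
Proof.
move=> d0 hK; rewrite /circle_mean EFinM lee_wpmul2l ?lee_fin ?invr_ge0 ?(ltW T0) //.
apply: (integral_psi_ge hpsi T0 cN N0) => e e0 _.
have m0 : 0 < Num.min d e by rewrite lt_min d0.
apply: le_trans (hK _ m0 _) _; first by rewrite ge_min lexx.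
apply: oint_le; [exact: ltW|exact: cpln|exact: cpln|] => t _.
apply: (real_restriction_nd hpsi).
by rewrite ler_ln ?posrE ?ltr_wpDl // lerD2l ge_min lexx orbT.
Qed.

Let support_mean (x0 b K e : R) : 0 <= b -> 0 < e ->
  K <= oint (fun t => ln (N t + e)) 0 (2 * pi) ->
  (p x0 - b * x0) * (2 * pi) + b * K <=
    oint (fun t => p x0 + b * (ln (N t + e) - x0)) 0 (2 * pi).
Proof.
move=> b0 e0 hK.
have -> : (fun t => p x0 + b * (ln (N t + e) - x0)) =
          (fun t => (p x0 - b * x0) + b * ln (N t + e)).
  by apply/funext => t; ring.
have c1 := cln e0.
have c2 : continuous (fun t => b * ln (N t + e)) by move=> t; apply: cvgMr; exact: c1.
have c3 : continuous (fun _ : R => p x0 - b * x0) by move=> t; exact: cvg_cst.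
by rewrite ointD // ointZ // oint_cst subr0 lerD2l ler_wpM2l.
Qed.

Let csupp (x0 b e : R) : 0 < e -> continuous (fun t => p x0 + b * (ln (N t + e) - x0)).
Proof.
move=> e0 t; apply: cvgD; first exact: cvg_cst.
by apply: cvgMr; apply: cvgB; [exact: cln|exact: cvg_cst].
Qed.

Let norm_gt0 : g 0 != 0 -> 0 < nrm (g 0).
Proof. by move=> g0; rewrite lt_def nrm_ge0 andbT; apply: contra_neq g0; exact: nrm_eq0. Qed.

(** At a zero of [g] the left side is [psi -oo], a lower bound of [p]. Otherwise the support line at
    [ln (nrm (g 0))] is integrated, its positive slope preserving the inequality for the
    logarithm. *)
Lemma psi_submean :
  (psi (log_norm (g 0%R)) <= circle_mean (fun x => psi (log_norm x)) g)%E.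
Proof.
have [g0|g0] := eqVneq (g 0) 0.
  rewrite {1}/log_norm g0 -[complex.Re _]/(nrm (0 : E)) nrm0 le0_lneNy //.
  case Em : (psi -oo) (psi_ltey hpsi (isT : -oo%E != +oo%E)) => [m| //|] _; last exact: leNye.
  apply: le_trans (@circle_mean_psi_ge (m * (2 * pi)) 1 ltr01 _).
    by rewrite mulrCA mulVf ?gt_eqF // mulr1.
  move=> e e0 _; rewrite -[2 * pi]subr0 -oint_cst subr0.
  apply: oint_le; [exact: ltW|by move=> t; exact: cvg_cst|exact: cpln|] => t _.
  by rewrite -lee_fin -Em; exact: psi_ninfty_le.
have n0 := norm_gt0 g0.
rewrite {1}/log_norm -[complex.Re _]/(nrm (g 0)) (psi_lne_gt0 hpsi) //.
have [b [b0 hb _]] := support_line hpsi (ln (nrm (g 0))).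
apply: le_trans (@circle_mean_psi_ge (p (ln (nrm (g 0))) * (2 * pi)) 1 ltr01 _).
  by rewrite mulrCA mulVf ?gt_eqF // mulr1.
move=> e e0 _.
have hK := log_mean_le_vector dg g0 e0.
have := @support_mean (ln (nrm (g 0))) b _ e (ltW b0) e0 hK.
move=> h; apply: (@le_trans _ _ ((p (ln (nrm (g 0))) - b * ln (nrm (g 0))) * (2 * pi) +
      b * (2 * pi * ln (nrm (g 0))))); first by lra.
apply: le_trans h _; apply: oint_le; [exact: ltW|exact: csupp|exact: cpln|] => t _.
exact: hb.
Qed.

Lemma psi_submean_strict : (exists2 z, closed_disc z & g z != 0) ->
  (exists t, N t != nrm (g 0)) ->
  (psi (log_norm (g 0%R)) < circle_mean (fun x => psi (log_norm x)) g)%E.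
Proof.
move=> gn0 [t' Nt'].
have [t1 ht1 Nt1] : exists2 t, 0 <= t <= 2 * pi & N t != nrm (g 0).
  by have [s hs st] := circle_point_surj t'; exists s => //; rewrite /N st.
have [g0|g0] := eqVneq (g 0) 0.
  rewrite {1}/log_norm g0 -[complex.Re _]/(nrm (0 : E)) nrm0 le0_lneNy //.
  case Em : (psi -oo) (psi_ltey hpsi (isT : -oo%E != +oo%E)) => [m| //|] _; last first.
    (* The left side is [-oo], so it is enough that the mean be finite; any support line transfers
       the bound on the logarithmic mean to [p]. *)
    have [K hK] := log_mean_bounded_below dg gn0.
    have [b [b0 hb _]] := support_line hpsi 0.
    apply: lt_le_trans (@circle_mean_psi_ge ((p 0 - b * 0) * (2 * pi) + b * K) 1 ltr01 _).
      exact: ltNyr.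
    move=> e e0 e1; apply: le_trans (@support_mean 0 b K e (ltW b0) e0 (hK e e0 e1)) _.
    apply: oint_le; [exact: ltW|exact: csupp|exact: cpln|] => t _; exact: hb.
  rewrite g0 nrm0 in Nt1.
  have Nt10 : 0 < N t1 by rewrite lt_def Nt1 N0.
  pose eta := N t1 / 2; have eta0 : 0 < eta by rewrite divr_gt0.
  have near_eta : \forall u \near t1, eta < N u.
    have h : eta < N t1 by rewrite /eta; lra.
    exact: (@cN t1 _ (lt_nbhsr h)).
  have [q1 [q2 [q0 q12 q2T hq]]] := near_segment T0 ht1 near_eta.
  have mp y : m <= p y by rewrite -lee_fin -Em; exact: psi_ninfty_le.
  (* Positive although [m] is only a weak lower bound of [p]: strict increase from [ln eta - 1] to
     [ln eta] leaves room. *)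
  pose k := p (ln eta) - m.
  have k0 : 0 < k.
    have := mp (ln eta - 1); have : p (ln eta - 1) < p (ln eta).
      by apply: (real_restriction_incr hpsi); lra.
    by rewrite /k; lra.
  apply: lt_le_trans (@circle_mean_psi_ge (m * (2 * pi) + k * (q2 - q1)) 1 ltr01 _).
    rewrite lte_fin mulrDr mulrCA mulVf ?gt_eqF // mulr1 ltrDl.
    by rewrite mulr_gt0 ?invr_gt0 // mulr_gt0 // subr_gt0.
  move=> e e0 _.
  have {1}-> : m * (2 * pi) = oint (fun=> m) 0 (2 * pi) by rewrite oint_cst subr0.
  apply: oint_ge_add => //; [exact: cpln|by move=> t; exact: cvg_cst|exact: ltW|].
  move=> t /hq etaN; rewrite /k addrC subrK; apply: (real_restriction_nd hpsi).
  by rewrite ler_ln ?posrE ?ltr_wpDl //; lra.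
have n0 := norm_gt0 g0; set M := nrm (g 0) in Nt1 n0 *.
rewrite {1}/log_norm -[complex.Re _]/M (psi_lne_gt0 hpsi) //.
have [b [b0 hb hbk]] := support_line hpsi (ln M).
(* Halfway between [N t1] and [M]: on an arc around [t1] the regularised norm stays on the far side
   of [r1], where the gap [k] over the support line applies. *)
pose r1 := (N t1 + M) / 2.
have r10 : 0 < r1 by rewrite /r1 divr_gt0 // ltr_wpDl.
have r1M : ln r1 != ln M.
  apply: contra_neq Nt1 => /(congr1 expR); rewrite !lnK ?posrE // /r1; lra.
have [k k0 hk] := hbk _ r1M.
suff [d d0 [q1 [q2 [q0 q12 q2T hq]]]] : exists2 d, 0 < d & exists q1 q2,
    [/\ 0 <= q1, q1 < q2, q2 <= 2 * pi & forall u, q1 <= u <= q2 -> forall e, 0 < e -> e <= d ->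
      (ln (N u + e) <= ln r1 < ln M) || (ln M < ln r1 <= ln (N u + e))].
  apply: lt_le_trans (@circle_mean_psi_ge (p (ln M) * (2 * pi) + k * (q2 - q1)) d d0 _).
    rewrite lte_fin mulrDr mulrCA mulVf ?gt_eqF // mulr1 ltrDl.
    by rewrite mulr_gt0 ?invr_gt0 // mulr_gt0 // subr_gt0.
  move=> e e0 ed.
  have hK := log_mean_le_vector dg g0 e0; rewrite -/M in hK.
  have h := @support_mean (ln M) b _ e (ltW b0) e0 hK.
  apply: (@le_trans _ _ (oint (fun t => p (ln M) + b * (ln (N t + e) - ln M)) 0 (2 * pi) +
     k * (q2 - q1))); first by rewrite lerD2r; lra.
  apply: oint_ge_add => //; [exact: cpln|exact: csupp|exact: ltW|].
  by move=> t ht; apply/hk/(hq t ht).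
have pos u e : 0 < e -> 0 < N u + e by move=> e0; rewrite ltr_wpDl.
have [ltN|gtN|E0] := ltgtP (N t1) M; last by rewrite E0 eqxx in Nt1.
(* A quarter of the distance is allowed to the variation of [N] and a quarter to [e], which together
   stop at [r1]. In the other case adding [e] only moves further from [M]. *)
- exists ((M - N t1) / 4); first by rewrite divr_gt0 // subr_gt0.
  have near_N : \forall u \near t1, N u < N t1 + (M - N t1) / 4.
    have h : N t1 < N t1 + (M - N t1) / 4 by lra.
    exact: (@cN t1 _ (lt_nbhsl h)).
  have [q1 [q2 [q0 q12 q2T hq]]] := near_segment T0 ht1 near_N.
  exists q1, q2; split => // u /hq hu e e0 ed; apply/orP; left.
  by rewrite ler_ln ?ltr_ln ?posrE ?pos //; apply/andP; split; rewrite /r1; lra.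
- exists 1 => //.
  have near_N : \forall u \near t1, r1 < N u.
    have h : r1 < N t1 by rewrite /r1; lra.
    exact: (@cN t1 _ (lt_nbhsr h)).
  have [q1 [q2 [q0 q12 q2T hq]]] := near_segment T0 ht1 near_N.
  exists q1, q2; split => // u /hq hu e e0 _; apply/orP; right.
  rewrite ler_ln ?ltr_ln ?posrE ?pos //; apply/andP; split; last by lra.
  by rewrite /r1; lra.
Qed.

End SubMean.

(** * The exponential as a strictly convex map *)

Section Exponential.
Variable R : realType.

(** The witness for (2) => (3), for which [psi (log_norm x)] is the norm itself. Strict convexity
    comes from the tangent at the intermediate point [m], which lies strictly below the graph at
    [x]. *)
Lemma expeR_strictly_convex : strictly_convex_map (@expeR R).
Proof.
split; last first.
  move=> x y t xy /andP[t0 t1]; rewrite /real_restriction /=.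
  set m := t * x + (1 - t) * y.
  have tangent z : expR m * (1 + (z - m)) <= expR z.
    have -> : expR z = expR m * expR (z - m) by rewrite -expRD subrKC.
    by rewrite ler_wpM2l ?expR_ge0 // expR_ge1Dx.
  have xm : x - m != 0.
    have -> : x - m = (1 - t) * (x - y) by rewrite /m; ring.
    by rewrite mulf_neq0 ?subr_eq0 // gt_eqF.
  have sx : expR m * (1 + (x - m)) < expR x.
    have -> : expR x = expR m * expR (x - m) by rewrite -expRD subrKC.
    by rewrite ltr_pM2l ?expR_gt0 // expR_gt1Dx.
  have -> : expR m = t * (expR m * (1 + (x - m))) + (1 - t) * (expR m * (1 + (y - m))).
    by rewrite /m; ring.
  apply: ltr_leD; first by rewrite ltr_pM2l.
  by rewrite ler_wpM2l // subr_ge0 ltW.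
split.
- by move=> u; rewrite /ninfty_line /= expeR_eqy.
- apply/subspace_continuousP => -[r| |] //= _ P.
  + move=> hP; have {}hP : nbhs r (fun u => P (expR u)%:E).
      exact: (@continuous_expR R r (fun v => P v%:E) hP).
    suff : nbhs r (fun u => ninfty_line u%:E -> P (expR u)%:E) by exact.
    by apply: filterS hP => u Pu _.
  + rewrite /= => hP; have {}hP : nbhs (0 : R) (fun u => P u%:E) by exact: hP.
    move/nbhs_ballP: hP => [d /= d0 hd].
    exists (ln d); split; first exact: num_real.
    move=> [r| |] //= h _.
    * apply: hd; rewrite -ball_normE /= sub0r normrN gtr0_norm ?expR_gt0 //.
      by rewrite -(lnK d0) ltr_expR -lte_fin.
    * by apply: hd; rewrite -ball_normE /= subrr normr0.
- by [].
- by move=> t x y _ _; rewrite /real_restriction /=; exact: convex_expR.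
Qed.

End Exponential.

(** * Plurisubharmonicity of the composite and the equivalence *)

Section LogNorm.
Variables (R : realType) (E : normedModType R[i]) (psi : \bar R -> \bar R).
Hypothesis hpsi : strictly_convex_map psi.

Lemma psi_log_norm_usc : upper_semicontinuous (fun x : E => psi (log_norm x)).
Proof.
move=> x a; rewrite /log_norm => /(psi_lne_right hpsi (nrm_ge0 x))[r' xr' ha].
have : \forall y \near x, nrm y < r' by exact: (@continuous_nrm R E x _ (lt_nbhsl xr')).
apply: filterS => y yr'; apply: le_lt_trans ha.
by apply: (psi_lne_nd hpsi); [exact: nrm_ge0|exact: ltW].
Qed.

Lemma circle_mean_eq (f : E -> \bar R) (gamma g : R[i]^o -> E) :
  (forall z, closed_disc z -> g z = gamma z) -> circle_mean f gamma = circle_mean f g.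
Proof.
move=> gE; rewrite /circle_mean; congr (_ * _)%E.
apply: eq_integral => t _; rewrite gE //; apply/closed_discE.
by rewrite nrm_circle_point.
Qed.

Lemma circle_mean_cst (f : E -> \bar R) (gamma : R[i]^o -> E) (c : R) :
  (forall z, closed_disc z -> f (gamma z) = c%:E) -> circle_mean f gamma = c%:E.
Proof.
move=> fc; have T0 : (0 : R) < 2 * pi by rewrite mulr_gt0 // pi_gt0.
rewrite /circle_mean (eq_integral (fun=> c%:E)); last first.
  by move=> t _; rewrite fc //; apply/closed_discE; rewrite nrm_circle_point.
rewrite (Rintegral_oint T0 (fun _ => cvg_cst _)) oint_cst subr0 -EFinM.
by rewrite mulrCA mulVf ?gt_eqF // mulr1.
Qed.

Lemma closed_disc0 : closed_disc (0 : R[i]^o).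
Proof. by apply/closed_discE; rewrite nrm0. Qed.

Lemma psi_log_norm_psh : plurisubharmonic (fun x : E => psi (log_norm x)).
Proof.
split.
- by move=> x; rewrite -ltey; exact: (psi_ltey hpsi (lne_EFin_neqy _)).
- exact: psi_log_norm_usc.
- move=> gamma [U [g [_ DU dg gE]]].
  rewrite (circle_mean_eq _ gE) -gE; last exact: closed_disc0.
  by apply: (psi_submean hpsi) => z /DU; exact: dg.
Qed.

Lemma psi_log_norm_spsh :
  (forall gamma : R[i]^o -> E, holomorphic_on_disc gamma ->
     (forall z, closed_disc z -> `|gamma z| = 1) -> constant_on_disc gamma) ->
  strictly_plurisubharmonic (fun x : E => psi (log_norm x)).
Proof.
move=> sphere; split; first exact: psi_log_norm_psh.
move=> gamma [U [g [oU DU dg gE]]] nconst.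
rewrite (circle_mean_eq _ gE) -gE; last exact: closed_disc0.
have dgD z : closed_disc z -> derivable g z 1 by move=> /DU; exact: dg.
(* Failure of either premise makes [gamma] constant: [g] vanishes on the disc, or its norm is
   constant on the circle. *)
apply: (psi_submean_strict hpsi dgD).
  apply: contrapT => gn; apply: nconst; exists 0 => z dz; rewrite -gE //.
  by apply: contrapT => /eqP gz; apply: gn; exists z.
apply: contrapT => Nn; apply: nconst.
have gM t : nrm (g (circle_point t)) = nrm (g 0).
  by apply: contrapT => /eqP gt; apply: Nn; exists t.
have {}gM := sphere_rigidity dgD gM.
have [M0|M0] := eqVneq (nrm (g 0)) 0.
  by exists 0 => z dz; rewrite -gE //; apply: nrm_eq0; rewrite gM.
(* Rescaling places the disc in the unit sphere, where the hypothesis applies. *)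
pose k : R[i] := (nrm (g 0))^-1%:C.
have k0 : k != 0.
  by rewrite /k; apply: contra_neq M0 => /complexI/eqP; rewrite invr_eq0 => /eqP.
have [||c hc] := sphere (fun z => k *: g z).
- exists U, (fun z => k *: g z); split => // z Uz.
  exact: (@derivableZ R[i] R[i]^o E g k z 1 (dg z Uz)).
- move=> z dz; rewrite nrmE nrmZ gM // nrm_real ger0_norm ?invr_ge0 ?nrm_ge0 //.
  by rewrite mulVf.
- exists (k^-1 *: c) => z dz; rewrite -gE // -(hc z dz).
  by rewrite scalerA mulVf // scale1r.
Qed.

End LogNorm.

Theorem theorem20 (R : realType) (E : completeNormedModType R[i]) :
  [<-> (forall gamma : R[i]^o -> E, holomorphic_on_disc gamma ->
          (forall z, closed_disc z -> `|gamma z| = 1) ->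
          constant_on_disc gamma);
       (forall psi : \bar R -> \bar R, strictly_convex_map psi ->
          strictly_plurisubharmonic (fun x : E => psi (log_norm x)));
       (exists2 psi : \bar R -> \bar R, strictly_convex_map psi &
          strictly_plurisubharmonic (fun x : E => psi (log_norm x)))].
Proof.
tfae.
- by move=> sphere psi hpsi; exact: psi_log_norm_spsh.
- move=> h; exists (@expeR R); first exact: expeR_strictly_convex.
  exact/h/expeR_strictly_convex.
- move=> [psi hpsi [_ strict]] gamma hol g1; apply: contrapT => nconst.
  have := strict gamma hol nconst.
  (* The logarithm of the norm is 0 on the disc, so centre value and circle mean both equal [psi 0],
     against strictness. *)
  have fE z : closed_disc z -> psi (log_norm (gamma z)) = (real_restriction psi 0)%:E.
    move=> dz; rewrite /log_norm g1 //.
    have -> : (complex.Re (1 : R[i]))%:E = 1%E :> \bar R by [].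
    by rewrite lne1 (psi_EFin hpsi).
  by rewrite (circle_mean_cst fE) fE ?ltxx //; exact: closed_disc0.
Qed.
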